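(* Let $a>b>0$ be fixed with $(\sqrt a-\sqrt b)^2>2$, let $\tau=\frac{a-b}{\log a-\log b}$ and $\lambda^*=\tau\frac{\log n}{n}$. Consider the two-cluster stochastic block model in which the true labeling $\sigma^*\in\{\pm1\}^n$ is arbitrary (any cluster sizes $0\le K_n\le n$, possibly depending on $n$). Let $\widehat Y'_{\mathrm{SDP}}$ be the solution of $$\max_Y\ \langle A,Y\rangle-\lambda^*\langle\mathbf J,Y\rangle\quad\text{s.t.}\quad Y\succeq0,\ \ Y_{ii}=1\ (i\in[n]).$$ Then $\min_{Y^*\in\mathcal Y'_n}\mathbb P\{\widehat Y'_{\mathrm{SDP}}=Y^*\}\ge 1-n^{-\Omega(1)}$ as $n\to\infty$, where $\mathcal Y'_n=\{\sigma\sigma^\top:\sigma\in\{\pm1\}^n\}$ and $\widehat Y'_{\mathrm{SDP}}=Y^*$ means $Y^*$ is the unique optimal solution.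
   Context: Given $\sigma^*\in\{\pm1\}^n$ (clusters $\{i:\sigma^*_i=1\}$ and $\{i:\sigma^*_i=-1\}$, one of which may be empty), each pair $\{i,j\}$ is independently connected with probability $p=a\log n/n$ if $\sigma^*_i=\sigma^*_j$ and $q=b\log n/n$ otherwise; $A$ is the adjacency matrix and $Y^*=\sigma^*(\sigma^* )^\top$. $\mathbf J$ is the all-ones matrix. *)

(* Defs.v *)
From Stdlib Require Import Reals List Arith Bool ClassicalEpsilon.
Import ListNotations.
Open Scope R_scope.

Fixpoint rsum (n : nat) (f : nat -> R) : R :=
  match n with O => 0 | S k => rsum k f + f k end.

(* Labels sigma : nat -> bool, with true = +1, false = -1 (only i < n matter). *)
Definition spin (s : nat -> bool) (i : nat) : R := if s i then 1 else -1.

Definition outer (s : nat -> bool) : nat -> nat -> R :=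
  fun i j => spin s i * spin s j.

Definition pairs (n : nat) : list (nat * nat) :=
  flat_map (fun j => map (fun i => (i, j)) (seq 0 j)) (seq 0 n).

Fixpoint all_bools (m : nat) : list (list bool) :=
  match m with
  | O => [nil]
  | S k => map (cons true) (all_bools k) ++ map (cons false) (all_bools k)
  end.

Definition configs (n : nat) : list (list bool) := all_bools (length (pairs n)).

Definition adj (n : nat) (c : list bool) (i j : nat) : R :=
  if existsb (fun e : (nat * nat) * bool =>
        let '((u, v), b) := e in
        b && ((Nat.eqb u i && Nat.eqb v j) || (Nat.eqb u j && Nat.eqb v i)))
      (combine (pairs n) c)
  then 1 else 0.

Definition p_in (a : R) (n : nat) : R := a * ln (INR n) / INR n.
Definition q_out (b : R) (n : nat) : R := b * ln (INR n) / INR n.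

Definition sbm_weight (a b : R) (n : nat) (s : nat -> bool) (c : list bool) : R :=
  fold_right Rmult 1
    (map (fun e : (nat * nat) * bool =>
            let '((u, v), x) := e in
            let pr := if Bool.eqb (s u) (s v) then p_in a n else q_out b n in
            if x then pr else 1 - pr)
         (combine (pairs n) c)).

Definition sbm_prob (a b : R) (n : nat) (s : nat -> bool) (E : list bool -> Prop) : R :=
  fold_right Rplus 0
    (map (fun c => sbm_weight a b n s c *
                   (if excluded_middle_informative (E c) then 1 else 0))
         (configs n)).

Definition psd (n : nat) (Y : nat -> nat -> R) : Prop :=
  (forall i j, (i < n)%nat -> (j < n)%nat -> Y i j = Y j i) /\
  forall x : nat -> R, 0 <= rsum n (fun i => rsum n (fun j => x i * Y i j * x j)).

Definition sdp_feasible (n : nat) (Y : nat -> nat -> R) : Prop :=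
  psd n Y /\ forall i, (i < n)%nat -> Y i i = 1.

Definition sdp_obj (n : nat) (A : nat -> nat -> R) (lam : R) (Y : nat -> nat -> R) : R :=
  rsum n (fun i => rsum n (fun j => (A i j - lam) * Y i j)).

Definition sdp_unique_opt (n : nat) (A : nat -> nat -> R) (lam : R)
    (Y0 : nat -> nat -> R) : Prop :=
  sdp_feasible n Y0 /\
  forall Y, sdp_feasible n Y ->
    sdp_obj n A lam Y >= sdp_obj n A lam Y0 ->
    forall i j, (i < n)%nat -> (j < n)%nat -> Y i j = Y0 i j.

Definition tau (a b : R) : R := (a - b) / (ln a - ln b).
Definition lambda_star (a b : R) (n : nat) : R := tau a b * ln (INR n) / INR n.

(* Main.v *)
Require Import Defs.
From Stdlib Require Import Reals Lra Lia List Arith Bool Classical ClassicalEpsilon.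
Import ListNotations.
Open Scope R_scope.

(** Write [W = A - P] with [P] the matrix of edge probabilities, [L = ln n], and let [d_i] be the
    row sums of [(A_ij - lam) s_i s_j].  The dual matrix [S = diag d - A + lam J] kills the spin
    vector [s], so it suffices that [S] is positive definite on the complement of [s].  Four
    families of Chernoff bounds hold with polynomially small failure probability:
    - the cut norm of [W] is at most [eta n L];
    - all degrees are [O(L)];
    - every set [T] of at most [delta n] vertices spans at most [eps L (|T| + 1)] edges;
    - [d_i >= e0 L] for all [i]; this is where [(sqrt a - sqrt b)^2 > 2] enters.
    The first three give [x^T W x <= kap L |x|^2] with [kap] small, which replaces the usual
    [sqrt L] bound on the spectral norm.  On the complement of [s] the remaining term is a
    multiple of [(sum x)^2], bounded by [(sum d_i x_i^2) (sum 1/d_i)], and the cut norm bound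
    applied to [s] shows that [sum 1/d_i] is close to its value at the mean of [d]. *)

(** * Finite sums and the edge distribution *)

(** Put al = a - tau, be = tau - b, w = L/n and rho = be/(al + be). The noise only has to be beaten
    on the scale L, which is why a soft bound kap L suffices. The real obstacle is the mean part: on
    the complement of s it acts as w (al - be)/2 J, which can have norm of order L, while the least
    d_i may be only a small multiple of L, so comparing it with the least d_i would fail. The sum of
    1/d_i instead reflects typical vertices. For every split into clusters its mean version is at
    most 2/(w (al + be)), so the mean part uses at most the fraction (al - be)/(al + be) = 1 - 2 rho
    of sum d_i x_i^2. One rho pays for replacing d by its mean, the other for the noise. No balance
    of the clusters enters because tau makes every vertex j contribute the same exponent to the
    lower tail of d_i, whichever cluster j lies in. The n equal contributions give n^(-(sqrt a -
    sqrt b)^2/2) up to constants and the e0 term, and the union over n vertices produces the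
    threshold 2. *)

Lemma rsum_ext (n : nat) (f g : nat -> R) :
  (forall i, (i < n)%nat -> f i = g i) -> rsum n f = rsum n g.
Proof.
  induction n as [|n IH]; intros H; simpl; [reflexivity|].
  rewrite IH, H by auto with arith; reflexivity.
Qed.

Lemma rsum_le (n : nat) (f g : nat -> R) :
  (forall i, (i < n)%nat -> f i <= g i) -> rsum n f <= rsum n g.
Proof.
  induction n as [|n IH]; intros H; simpl; [lra|].
  apply Rplus_le_compat; auto with arith.
Qed.

Lemma rsum_plus (n : nat) (f g : nat -> R) :
  rsum n (fun i => f i + g i) = rsum n f + rsum n g.
Proof. induction n as [|n IH]; simpl; [|rewrite IH]; ring. Qed.

Lemma rsum_scal (n : nat) (c : R) (f : nat -> R) :
  rsum n (fun i => c * f i) = c * rsum n f.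
Proof. induction n as [|n IH]; simpl; [|rewrite IH]; ring. Qed.

Lemma rsum_scal_r (n : nat) (c : R) (f : nat -> R) :
  rsum n (fun i => f i * c) = rsum n f * c.
Proof. induction n as [|n IH]; simpl; [|rewrite IH]; ring. Qed.

Lemma rsum_minus (n : nat) (f g : nat -> R) :
  rsum n (fun i => f i - g i) = rsum n f - rsum n g.
Proof. induction n as [|n IH]; simpl; [|rewrite IH]; ring. Qed.

Lemma rsum_const (n : nat) (c : R) : rsum n (fun _ => c) = INR n * c.
Proof.
  induction n as [|n IH]; [simpl; ring|].
  rewrite S_INR; simpl; rewrite IH; ring.
Qed.

Lemma rsum_zero (n : nat) (f : nat -> R) :
  (forall i, (i < n)%nat -> f i = 0) -> rsum n f = 0.
Proof.
  intros H; rewrite (rsum_ext n f (fun _ => 0)) by assumption.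
  rewrite rsum_const; ring.
Qed.

Lemma rsum_nonneg (n : nat) (f : nat -> R) :
  (forall i, (i < n)%nat -> 0 <= f i) -> 0 <= rsum n f.
Proof.
  intros H; replace 0 with (rsum n (fun _ => 0)) by (rewrite rsum_const; ring).
  now apply rsum_le.
Qed.

Lemma rsum_term_le (n k : nat) (f : nat -> R) :
  (forall i, (i < n)%nat -> 0 <= f i) -> (k < n)%nat -> f k <= rsum n f.
Proof.
  induction n as [|n IH]; intros H Hk; [lia|]; simpl.
  assert (H0 : 0 <= rsum n f) by (apply rsum_nonneg; auto with arith).
  pose proof (H n (Nat.lt_succ_diag_r n)).
  destruct (Nat.eq_dec k n) as [->|Hn]; [lra|].
  assert (f k <= rsum n f) by (apply IH; [auto with arith|lia]); lra.
Qed.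

Lemma rsum_swap (m n : nat) (f : nat -> nat -> R) :
  rsum m (fun i => rsum n (fun j => f i j)) = rsum n (fun j => rsum m (fun i => f i j)).
Proof.
  induction m as [|m IH]; simpl.
  - now rewrite rsum_zero.
  - now rewrite IH, rsum_plus.
Qed.

Lemma rsum_delta (n k : nat) (f : nat -> R) :
  (k < n)%nat -> rsum n (fun i => if Nat.eqb i k then f i else 0) = f k.
Proof.
  induction n as [|n IH]; intros Hk; [lia|]; simpl.
  destruct (Nat.eqb_spec n k) as [->|Hn].
  - rewrite rsum_zero; [ring|].
    intros i Hi; destruct (Nat.eqb_spec i k); [lia|reflexivity].
  - rewrite IH by lia; ring.
Qed.

Definition dsum (n : nat) (f : nat -> nat -> R) : R :=
  rsum n (fun i => rsum n (fun j => f i j)).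

Lemma dsum_ext (n : nat) (f g : nat -> nat -> R) :
  (forall i j, (i < n)%nat -> (j < n)%nat -> f i j = g i j) -> dsum n f = dsum n g.
Proof. intros H; apply rsum_ext; intros; apply rsum_ext; auto. Qed.

Lemma dsum_le (n : nat) (f g : nat -> nat -> R) :
  (forall i j, (i < n)%nat -> (j < n)%nat -> f i j <= g i j) -> dsum n f <= dsum n g.
Proof. intros H; apply rsum_le; intros; apply rsum_le; auto. Qed.

Lemma dsum_plus (n : nat) (f g : nat -> nat -> R) :
  dsum n (fun i j => f i j + g i j) = dsum n f + dsum n g.
Proof.
  unfold dsum; rewrite <- rsum_plus; apply rsum_ext; intros; apply rsum_plus.
Qed.

Lemma dsum_minus (n : nat) (f g : nat -> nat -> R) :
  dsum n (fun i j => f i j - g i j) = dsum n f - dsum n g.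
Proof.
  unfold dsum; rewrite <- rsum_minus; apply rsum_ext; intros; apply rsum_minus.
Qed.

Lemma dsum_scal (n : nat) (c : R) (f : nat -> nat -> R) :
  dsum n (fun i j => c * f i j) = c * dsum n f.
Proof.
  unfold dsum; rewrite <- rsum_scal; apply rsum_ext; intros; apply rsum_scal.
Qed.

Lemma dsum_swap (n : nat) (f : nat -> nat -> R) :
  dsum n f = dsum n (fun i j => f j i).
Proof. apply rsum_swap. Qed.

Lemma dsum_prod (n : nat) (f g : nat -> R) :
  dsum n (fun i j => f i * g j) = rsum n f * rsum n g.
Proof.
  unfold dsum; rewrite <- rsum_scal_r; apply rsum_ext; intros; apply rsum_scal.
Qed.

Lemma dsum_delta_row (n k : nat) (f : nat -> nat -> R) :
  (k < n)%nat ->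
  dsum n (fun i j => if Nat.eqb i k then f i j else 0) = rsum n (fun j => f k j).
Proof.
  intros Hk; unfold dsum.
  rewrite <- (rsum_delta n k (fun i => rsum n (fun j => f i j))) by assumption.
  apply rsum_ext; intros i _; destruct (Nat.eqb i k); [reflexivity|].
  now apply rsum_zero.
Qed.

Lemma dsum_diag (n : nat) (f : nat -> R) :
  dsum n (fun i j => if Nat.eqb j i then f j else 0) = rsum n f.
Proof. apply rsum_ext; intros i Hi; now rewrite rsum_delta. Qed.

Definition upper (n : nat) (g : nat -> nat -> R) : R :=
  rsum n (fun j => rsum j (fun i => g i j)).

Lemma upper_le (n : nat) (f g : nat -> nat -> R) :
  (forall i j, (i < j)%nat -> (j < n)%nat -> f i j <= g i j) -> upper n f <= upper n g.
Proof. intros H; apply rsum_le; intros; apply rsum_le; auto. Qed.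

Lemma upper_ext (n : nat) (f g : nat -> nat -> R) :
  (forall i j, (i < j)%nat -> (j < n)%nat -> f i j = g i j) -> upper n f = upper n g.
Proof. intros H; apply rsum_ext; intros; apply rsum_ext; auto. Qed.

(** Randomness lives on pairs i < j, while statistics of the graph are full double sums. This is the
    passage between the two, and the source of the diagonal corrections in the Chernoff
    exponents. *)
Lemma upper_symmetrize (n : nat) (g : nat -> nat -> R) :
  upper n (fun i j => g i j + g j i) = dsum n g - rsum n (fun i => g i i).
Proof.
  unfold upper, dsum; induction n as [|n IH]; simpl; [ring|].
  rewrite IH, !rsum_plus; change (rsum n (g n)) with (rsum n (fun j => g n j)); ring.
Qed.

(** * Sums and products over lists *)

Definition lsum {T : Type} (l : list T) (f : T -> R) : R :=
  fold_right Rplus 0 (map f l).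

Definition lprod {T : Type} (l : list T) (f : T -> R) : R :=
  fold_right Rmult 1 (map f l).

Lemma lsum_cons {T : Type} (x : T) (l : list T) (f : T -> R) :
  lsum (x :: l) f = f x + lsum l f.
Proof. reflexivity. Qed.

Lemma lprod_cons {T : Type} (x : T) (l : list T) (f : T -> R) :
  lprod (x :: l) f = f x * lprod l f.
Proof. reflexivity. Qed.

Lemma lsum_app {T : Type} (l1 l2 : list T) (f : T -> R) :
  lsum (l1 ++ l2) f = lsum l1 f + lsum l2 f.
Proof.
  induction l1 as [|x l1 IH]; simpl; [unfold lsum at 2; simpl; ring|].
  rewrite !lsum_cons, IH; ring.
Qed.

Lemma lsum_map {S T : Type} (g : S -> T) (l : list S) (f : T -> R) :
  lsum (map g l) f = lsum l (fun x => f (g x)).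
Proof. unfold lsum; now rewrite map_map. Qed.

Lemma lsum_ext {T : Type} (l : list T) (f g : T -> R) :
  (forall x, In x l -> f x = g x) -> lsum l f = lsum l g.
Proof. intros H; unfold lsum; now rewrite (map_ext_in f g l H). Qed.

Lemma lsum_le {T : Type} (l : list T) (f g : T -> R) :
  (forall x, In x l -> f x <= g x) -> lsum l f <= lsum l g.
Proof.
  induction l as [|x l IH]; intros H; [apply Rle_refl|].
  rewrite !lsum_cons; apply Rplus_le_compat; [|apply IH]; intros; apply H; simpl; auto.
Qed.

Lemma lsum_const {T : Type} (l : list T) (c : R) :
  lsum l (fun _ => c) = INR (length l) * c.
Proof.
  induction l as [|x l IH]; [unfold lsum; simpl; ring|].
  rewrite lsum_cons, IH; cbn [length]; rewrite S_INR; ring.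
Qed.

Lemma lsum_plus {T : Type} (l : list T) (f g : T -> R) :
  lsum l (fun x => f x + g x) = lsum l f + lsum l g.
Proof.
  induction l as [|x l IH]; [unfold lsum; simpl; ring|].
  rewrite !lsum_cons, IH; ring.
Qed.

Lemma lsum_scal {T : Type} (l : list T) (c : R) (f : T -> R) :
  lsum l (fun x => c * f x) = c * lsum l f.
Proof.
  induction l as [|x l IH]; [unfold lsum; simpl; ring|].
  rewrite !lsum_cons, IH; ring.
Qed.

Lemma lsum_swap {S T : Type} (l : list S) (m : list T) (f : S -> T -> R) :
  lsum l (fun x => lsum m (fun y => f x y)) = lsum m (fun y => lsum l (fun x => f x y)).
Proof.
  induction l as [|x l IH].
  - unfold lsum at 1; simpl.
    rewrite (lsum_ext m _ (fun _ => 0)) by reflexivity; rewrite lsum_const; ring.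
  - rewrite lsum_cons, IH, <- lsum_plus; reflexivity.
Qed.

Lemma lsum_term_le {T : Type} (l : list T) (f : T -> R) (x : T) :
  (forall y, In y l -> 0 <= f y) -> In x l -> f x <= lsum l f.
Proof.
  induction l as [|y l IH]; intros H Hx; [easy|]; rewrite lsum_cons.
  assert (H0 : 0 <= lsum l f).
  { apply Rle_trans with (lsum l (fun _ => 0)); [rewrite lsum_const; lra|].
    apply lsum_le; intros; apply H; simpl; auto. }
  pose proof (H y (or_introl eq_refl)).
  destruct Hx as [->|Hx]; [lra|].
  assert (f x <= lsum l f) by (apply IH; [intros; apply H; simpl; auto|assumption]); lra.
Qed.

Lemma lsum_seq (n : nat) (f : nat -> R) : lsum (seq 0 n) f = rsum n f.
Proof.
  induction n as [|n IH]; [reflexivity|].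
  rewrite seq_S, lsum_app, IH; unfold lsum; simpl; ring.
Qed.

Lemma lsum_pairs (n : nat) (g : nat -> nat -> R) :
  lsum (pairs n) (fun e => g (fst e) (snd e)) = upper n g.
Proof.
  unfold pairs, upper; induction n as [|n IH]; [reflexivity|].
  rewrite seq_S, flat_map_app, lsum_app, IH; simpl.
  rewrite app_nil_r, lsum_map; simpl; now rewrite lsum_seq.
Qed.

Lemma lprod_mult {T : Type} (l : list T) (f g : T -> R) :
  lprod l f * lprod l g = lprod l (fun x => f x * g x).
Proof.
  induction l as [|x l IH]; [unfold lprod; simpl; ring|].
  rewrite !lprod_cons, <- IH; ring.
Qed.

Lemma lprod_exp {T : Type} (l : list T) (f : T -> R) :
  lprod l (fun x => exp (f x)) = exp (lsum l f).
Proof.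
  induction l as [|x l IH]; [unfold lprod, lsum; simpl; now rewrite exp_0|].
  now rewrite lprod_cons, lsum_cons, IH, exp_plus.
Qed.

Lemma lprod_nonneg {T : Type} (l : list T) (f : T -> R) :
  (forall x, In x l -> 0 <= f x) -> 0 <= lprod l f.
Proof.
  induction l as [|x l IH]; intros H; [unfold lprod; simpl; lra|].
  rewrite lprod_cons; apply Rmult_le_pos; [|apply IH; intros]; apply H; simpl; auto.
Qed.

Lemma lprod_le {T : Type} (l : list T) (f g : T -> R) :
  (forall x, In x l -> 0 <= f x <= g x) -> lprod l f <= lprod l g.
Proof.
  induction l as [|x l IH]; intros H; [apply Rle_refl|].
  rewrite !lprod_cons; apply Rmult_le_compat.
  - apply H; simpl; auto.
  - apply lprod_nonneg; intros; apply H; simpl; auto.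
  - apply H; simpl; auto.
  - apply IH; intros; apply H; simpl; auto.
Qed.

(** * Edge configurations and the adjacency matrix *)

Lemma all_bools_length (m : nat) (c : list bool) :
  In c (all_bools m) <-> length c = m.
Proof.
  revert c; induction m as [|m IH]; intros c; simpl.
  - split; [intros [<-|[]]; reflexivity|]; destruct c; simpl; auto; discriminate.
  - rewrite in_app_iff, !in_map_iff; split.
    + intros [[c' [<- H]]|[c' [<- H]]]; simpl; f_equal; now apply IH.
    + destruct c as [|[] c]; simpl; intros H; [discriminate|left|right];
        exists c; split; auto; apply IH; lia.
Qed.

Lemma length_all_bools (m : nat) : INR (length (all_bools m)) = 2 ^ m.
Proof.
  induction m as [|m IH]; [reflexivity|]; simpl.
  rewrite length_app, !length_map, plus_INR, IH; ring.
Qed.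

(** Distributivity. This is how independence of the edges enters: the expectation of a product over
    edges factorizes. *)
Lemma lsum_all_bools_lprod {T : Type} (l : list T) (h : T * bool -> R) :
  lsum (all_bools (length l)) (fun c => lprod (combine l c) h) =
  lprod l (fun e => h (e, true) + h (e, false)).
Proof.
  induction l as [|e l IH]; simpl.
  - unfold lsum, lprod; simpl; ring.
  - rewrite lsum_app, !lsum_map; cbn [combine].
    rewrite (lsum_ext _ (fun c => lprod ((e, true) :: combine l c) h)
              (fun c => h (e, true) * lprod (combine l c) h)) by reflexivity.
    rewrite (lsum_ext _ (fun c => lprod ((e, false) :: combine l c) h)
              (fun c => h (e, false) * lprod (combine l c) h)) by reflexivity.
    rewrite !lsum_scal, IH, lprod_cons; ring.
Qed.

Lemma lsum_combine_fst {S T : Type} (l : list S) (c : list T) (f : S -> R) :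
  length l = length c -> lsum (combine l c) (fun e => f (fst e)) = lsum l f.
Proof.
  revert c; induction l as [|x l IH]; intros [|y c] H; simpl in H; try discriminate.
  - reflexivity.
  - cbn [combine]; rewrite !lsum_cons, IH by lia; reflexivity.
Qed.

Lemma in_pairs (n i j : nat) : In (i, j) (pairs n) <-> (i < j /\ j < n)%nat.
Proof.
  unfold pairs; rewrite in_flat_map; split.
  - intros [k [Hk Hi]]; apply in_map_iff in Hi; destruct Hi as [l [E Hl]].
    injection E as <- <-; apply in_seq in Hk; apply in_seq in Hl; lia.
  - intros [Hi Hj]; exists j; split; [apply in_seq; lia|].
    apply in_map_iff; exists i; split; [reflexivity|apply in_seq; lia].
Qed.

Lemma NoDup_pairs (n : nat) : NoDup (pairs n).
Proof.
  unfold pairs; induction n as [|n IH]; [constructor|].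
  rewrite seq_S, flat_map_app; apply NoDup_app; [exact IH| |].
  - simpl; rewrite app_nil_r; apply NoDup_map_NoDup_ForallPairs; [|apply seq_NoDup].
    intros x y _ _ E; now injection E.
  - intros [u v] H1 H2; apply (in_pairs n) in H1; simpl in H2.
    rewrite app_nil_r in H2; apply in_map_iff in H2; destruct H2 as [k [E _]].
    injection E as <- <-; lia.
Qed.

Lemma combine_functional {S T : Type} (l : list S) (c : list T) (x : S) (y z : T) :
  NoDup l -> In (x, y) (combine l c) -> In (x, z) (combine l c) -> y = z.
Proof.
  revert c; induction l as [|s l IH]; intros [|t c] Hd H1 H2; simpl in *; try easy.
  inversion_clear Hd as [|? ? Hs Hl].
  destruct H1 as [H1|H1], H2 as [H2|H2].
  - congruence.
  - injection H1 as -> ->; apply in_combine_l in H2; contradiction.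
  - injection H2 as -> ->; apply in_combine_l in H1; contradiction.
  - eauto.
Qed.

Lemma adj_01 (n : nat) (c : list bool) (i j : nat) : adj n c i j = 0 \/ adj n c i j = 1.
Proof. unfold adj; destruct existsb; auto. Qed.

Lemma adj_diag (n : nat) (c : list bool) (i : nat) : adj n c i i = 0.
Proof.
  unfold adj; match goal with |- context [existsb ?f ?l] => destruct (existsb f l) eqn:E end; auto.
  apply existsb_exists in E; destruct E as [[[u v] x] [Hin H]].
  apply in_combine_l, in_pairs in Hin.
  apply andb_prop in H; destruct H as [_ H].
  apply orb_prop in H; destruct H as [H|H]; apply andb_prop in H; destruct H as [H1 H2];
    apply Nat.eqb_eq in H1, H2; lia.
Qed.

Lemma existsb_ext {T : Type} (f g : T -> bool) (l : list T) :
  (forall x, f x = g x) -> existsb f l = existsb g l.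
Proof. intros H; induction l as [|x l IH]; simpl; [|rewrite H, IH]; reflexivity. Qed.

Lemma adj_sym (n : nat) (c : list bool) (i j : nat) : adj n c i j = adj n c j i.
Proof.
  unfold adj.
  match goal with |- (if existsb ?f ?l then _ else _) = (if existsb ?g _ then _ else _) =>
    rewrite (existsb_ext f g l); [reflexivity|] end.
  intros [[u v] x]; now rewrite orb_comm.
Qed.

(** [pairs] has no repetition and lists only pairs with first entry below the second, so the search
    in [adj] can meet just this one bit. *)
Lemma adj_combine (n : nat) (c : list bool) (u v : nat) (x : bool) :
  In ((u, v), x) (combine (pairs n) c) -> adj n c u v = if x then 1 else 0.
Proof.
  intros Hin; unfold adj.
  match goal with |- context [existsb ?f ?l] => destruct (existsb f l) eqn:E end.
  - apply existsb_exists in E; destruct E as [[[u' v'] y] [Hin' H]].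
    pose proof (in_combine_l _ _ _ _ Hin) as H1; apply in_pairs in H1.
    pose proof (in_combine_l _ _ _ _ Hin') as H2; apply in_pairs in H2.
    apply andb_prop in H; destruct H as [-> H].
    apply orb_prop in H; destruct H as [H|H]; apply andb_prop in H; destruct H as [H3 H4];
      apply Nat.eqb_eq in H3, H4; [subst u' v'|lia].
    now rewrite (combine_functional _ _ _ _ _ (NoDup_pairs n) Hin Hin').
  - destruct x; [|reflexivity]; exfalso.
    rewrite <- not_true_iff_false in E; apply E, existsb_exists.
    exists ((u, v), true); split; [assumption|]; now rewrite !Nat.eqb_refl.
Qed.

Lemma dsum_adj (n : nat) (c : list bool) (f : nat -> nat -> R) :
  In c (configs n) ->
  dsum n (fun i j => adj n c i j * f i j) =
  lsum (combine (pairs n) c)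
    (fun e => if snd e then f (fst (fst e)) (snd (fst e)) + f (snd (fst e)) (fst (fst e)) else 0).
Proof.
  intros Hc; apply all_bools_length in Hc.
  transitivity (upper n (fun i j => adj n c i j * f i j + adj n c j i * f j i)).
  { rewrite upper_symmetrize, (rsum_zero n (fun i => _)); [ring|].
    intros; rewrite adj_diag; ring. }
  rewrite <- (lsum_pairs n (fun i j => adj n c i j * f i j + adj n c j i * f j i)).
  rewrite <- (lsum_combine_fst (pairs n) c) by auto.
  apply lsum_ext; intros [[u v] x] Hin; simpl.
  rewrite (adj_sym n c v u), (adj_combine _ _ _ _ _ Hin); destruct x; ring.
Qed.

(** * Exponential moments and the union bound *)

Definition edge_prob (a b : R) (n : nat) (s : nat -> bool) (i j : nat) : R :=
  if Bool.eqb (s i) (s j) then p_in a n else q_out b n.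

Section Probability.

Variables (a b : R) (n : nat) (s : nat -> bool).
Hypothesis edge_prob_01 : forall i j, 0 <= edge_prob a b n s i j <= 1.

Definition edge_weight (e : (nat * nat) * bool) : R :=
  let pr := edge_prob a b n s (fst (fst e)) (snd (fst e)) in
  if snd e then pr else 1 - pr.

Lemma sbm_weight_lprod (c : list bool) :
  sbm_weight a b n s c = lprod (combine (pairs n) c) edge_weight.
Proof.
  unfold sbm_weight, lprod; f_equal; apply map_ext; intros [[u v] x]; reflexivity.
Qed.

Lemma sbm_weight_nonneg (c : list bool) : 0 <= sbm_weight a b n s c.
Proof.
  rewrite sbm_weight_lprod; apply lprod_nonneg; intros [[u v] x] _.
  unfold edge_weight; simpl; pose proof (edge_prob_01 u v); destruct x; lra.
Qed.

Lemma sbm_weight_total : lsum (configs n) (sbm_weight a b n s) = 1.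
Proof.
  unfold configs; rewrite (lsum_ext _ _ _ (fun c _ => sbm_weight_lprod c)).
  rewrite lsum_all_bools_lprod; unfold edge_weight; simpl.
  induction (pairs n) as [|e l IH]; [reflexivity|].
  rewrite lprod_cons, IH; ring.
Qed.

(** Bounds the expectation of exp(<A, f> - t): each edge has moment generating factor 1 + p (e^x -
    1) <= exp(p (e^x - 1)), where x = f i j + f j i because an edge appears in both orientations.
    The tilt is absorbed into [f] and [t]. *)
Definition chernoff_bound (f : nat -> nat -> R) (t : R) : R :=
  exp (upper n (fun i j => edge_prob a b n s i j * (exp (f i j + f j i) - 1)) - t).

Lemma expectation_exp_le (f : nat -> nat -> R) (t : R) :
  lsum (configs n) (fun c => sbm_weight a b n s c *
    exp (dsum n (fun i j => adj n c i j * f i j) - t)) <= chernoff_bound f t.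
Proof.
  set (g := fun e : nat * nat => f (fst e) (snd e) + f (snd e) (fst e)).
  rewrite (lsum_ext _ _ (fun c => exp (- t) * lprod (combine (pairs n) c)
    (fun e => edge_weight e * exp (if snd e then g (fst e) else 0)))).
  2: { intros c Hc; rewrite (dsum_adj n c f Hc).
       rewrite <- (lprod_mult _ edge_weight), lprod_exp, sbm_weight_lprod.
       unfold Rminus; rewrite exp_plus; unfold g; ring. }
  rewrite lsum_scal; unfold configs; rewrite lsum_all_bools_lprod.
  unfold chernoff_bound, Rminus at 1; rewrite exp_plus, Rmult_comm.
  apply Rmult_le_compat_r; [left; apply exp_pos|].
  rewrite <- (lsum_pairs n (fun i j => _)), <- lprod_exp; apply lprod_le.
  intros [u v] _; unfold edge_weight; simpl.
  change (f u v + f v u) with (g (u, v)).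
  pose proof (edge_prob_01 u v); pose proof (exp_pos (g (u, v))); rewrite exp_0; split.
  - apply Rplus_le_le_0_compat; apply Rmult_le_pos; lra.
  - eapply Rle_trans; [|apply exp_ineq1_le]; nra.
Qed.

(** Markov's inequality and the union bound in one step: where [E] fails, some constraint k is
    violated, so its exponential is at least 1 and the sum of exponentials dominates the indicator
    of failure. *)
Lemma sbm_prob_union_bound (E : list bool -> Prop) {K : Type} (l : list K)
    (f : K -> nat -> nat -> R) (t : K -> R) :
  (forall c, (forall k, In k l -> dsum n (fun i j => adj n c i j * f k i j) <= t k) -> E c) ->
  sbm_prob a b n s E >= 1 - lsum l (fun k => chernoff_bound (f k) (t k)).
Proof.
  intros HE.
  assert (H : lsum (configs n) (sbm_weight a b n s) <= sbm_prob a b n s E +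
    lsum (configs n) (fun c => lsum l (fun k => sbm_weight a b n s c *
      exp (dsum n (fun i j => adj n c i j * f k i j) - t k)))).
  { unfold sbm_prob; fold (lsum (configs n) (fun c => sbm_weight a b n s c *
      (if excluded_middle_informative (E c) then 1 else 0))).
    rewrite <- lsum_plus; apply lsum_le; intros c _.
    rewrite lsum_scal; pose proof (sbm_weight_nonneg c) as Hw.
    assert (Hexp : forall k, In k l -> 0 <= exp (dsum n (fun i j => adj n c i j * f k i j) - t k))
      by (intros; left; apply exp_pos).
    destruct (excluded_middle_informative (E c)) as [Hc|Hc].
    - assert (0 <= lsum l (fun k => exp (dsum n (fun i j => adj n c i j * f k i j) - t k))).
      { apply Rle_trans with (lsum l (fun _ => 0)); [rewrite lsum_const; lra|].
        now apply lsum_le. }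
      nra.
    - assert (exists k, In k l /\ t k < dsum n (fun i j => adj n c i j * f k i j)) as [k [Hk Ht]].
      { apply NNPP; intros Hn; apply Hc, HE; intros k Hk; apply Rnot_lt_le; intros Hlt.
        apply Hn; now exists k. }
      pose proof (lsum_term_le l _ k Hexp Hk) as Hle; cbn beta in Hle.
      assert (1 <= exp (dsum n (fun i j => adj n c i j * f k i j) - t k)).
      { eapply Rle_trans; [|apply exp_ineq1_le]; lra. }
      nra. }
  rewrite sbm_weight_total, lsum_swap in H.
  assert (lsum l (fun k => lsum (configs n) (fun c => sbm_weight a b n s c *
      exp (dsum n (fun i j => adj n c i j * f k i j) - t k))) <=
      lsum l (fun k => chernoff_bound (f k) (t k))).
  { apply lsum_le; intros; apply expectation_exp_le. }
  lra.
Qed.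

End Probability.

(** * Dual certificates *)

Definition quad (n : nat) (Y : nat -> nat -> R) (x : nat -> R) : R :=
  dsum n (fun i j => x i * Y i j * x j).

Definition unit_vec (k : nat) (i : nat) : R := if Nat.eqb i k then 1 else 0.

Lemma quad_shift (n k : nat) (Y : nat -> nat -> R) (x : nat -> R) (t : R) :
  (forall i j, (i < n)%nat -> (j < n)%nat -> Y i j = Y j i) -> (k < n)%nat ->
  quad n Y (fun i => x i - t * unit_vec k i) =
  quad n Y x - 2 * t * rsum n (fun j => x j * Y j k) + t ^ 2 * Y k k.
Proof.
  intros Hs Hk; unfold quad.
  rewrite (dsum_ext n _ (fun i j => x i * Y i j * x j -
    t * ((if Nat.eqb i k then Y i j * x j else 0) + (if Nat.eqb j k then x i * Y i j else 0)) +
    t ^ 2 * (if Nat.eqb i k then if Nat.eqb j k then Y i j else 0 else 0))).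
  2: { intros i j _ _; unfold unit_vec; destruct (Nat.eqb i k), (Nat.eqb j k); ring. }
  rewrite dsum_plus, dsum_minus, !dsum_scal, dsum_plus.
  rewrite (dsum_delta_row n k (fun i j => Y i j * x j)) by assumption.
  rewrite (dsum_swap n (fun i j => if Nat.eqb j k then x i * Y i j else 0)).
  rewrite (dsum_delta_row n k (fun j i => x i * Y i j)) by assumption.
  rewrite (dsum_delta_row n k (fun i j => if Nat.eqb j k then Y i j else 0)) by assumption.
  rewrite rsum_delta by assumption.
  rewrite (rsum_ext n (fun j => Y k j * x j) (fun j => x j * Y j k)); [ring|].
  intros j Hj; rewrite (Hs k j) by assumption; ring.
Qed.

(** Positivity at x - t e_k is a quadratic polynomial in t; the facts about psd matrices below
    differ only in the choice of [x] and [t]. *)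
Lemma psd_shift_nonneg (n k : nat) (Y : nat -> nat -> R) (x : nat -> R) (t : R) :
  psd n Y -> (k < n)%nat ->
  0 <= quad n Y x - 2 * t * rsum n (fun j => x j * Y j k) + t ^ 2 * Y k k.
Proof. intros [Hs Hp] Hk; rewrite <- quad_shift by assumption; apply Hp. Qed.

Lemma quad_unit_vec (n k : nat) (Y : nat -> nat -> R) :
  (k < n)%nat -> quad n Y (unit_vec k) = Y k k.
Proof.
  intros Hk; unfold quad.
  rewrite (dsum_ext n _ (fun i j => if Nat.eqb i k then if Nat.eqb j k then Y i j else 0 else 0)).
  2: { intros i j _ _; unfold unit_vec; destruct (Nat.eqb i k), (Nat.eqb j k); ring. }
  now rewrite (dsum_delta_row n k (fun i j => if Nat.eqb j k then Y i j else 0)), rsum_delta.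
Qed.

Lemma rsum_unit_vec (n k : nat) (f : nat -> R) :
  (k < n)%nat -> rsum n (fun j => unit_vec k j * f j) = f k.
Proof.
  intros Hk; rewrite <- (rsum_delta n k f) by assumption.
  apply rsum_ext; intros j _; unfold unit_vec; destruct (Nat.eqb j k); ring.
Qed.

Lemma psd_diag_nonneg (n k : nat) (Y : nat -> nat -> R) :
  psd n Y -> (k < n)%nat -> 0 <= Y k k.
Proof. intros [_ Hp] Hk; rewrite <- (quad_unit_vec n k Y Hk); apply Hp. Qed.

Lemma psd_zero_diag (n k j : nat) (Y : nat -> nat -> R) :
  psd n Y -> (k < n)%nat -> (j < n)%nat -> Y k k = 0 -> Y j k = 0.
Proof.
  intros HY Hk Hj H0.
  destruct (Req_dec (Y j k) 0) as [|Hne]; [assumption|exfalso].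
  (* As Y k k = 0, the polynomial is affine in t, and at this t it equals Y j j - 2 (Y j j + 1) <
     0. *)
  pose proof (psd_shift_nonneg n k Y (unit_vec j) ((Y j j + 1) / Y j k) HY Hk) as H.
  rewrite quad_unit_vec, (rsum_unit_vec n j (fun i => Y i k)), H0 in H by assumption.
  pose proof (psd_diag_nonneg n j Y HY Hj).
  replace (2 * ((Y j j + 1) / Y j k) * Y j k) with (2 * (Y j j + 1)) in H by (field; assumption).
  lra.
Qed.

Definition schur (Y : nat -> nat -> R) (k i j : nat) : R := Y i j - Y i k * Y j k / Y k k.

Lemma quad_schur (n k : nat) (Y : nat -> nat -> R) (x : nat -> R) :
  quad n (schur Y k) x = quad n Y x - rsum n (fun j => x j * Y j k) ^ 2 / Y k k.
Proof.
  unfold quad, schur.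
  rewrite (dsum_ext n _ (fun i j => x i * Y i j * x j - / Y k k * ((x i * Y i k) * (x j * Y j k))))
    by (intros; unfold Rdiv; ring).
  rewrite dsum_minus, dsum_scal, dsum_prod; unfold Rdiv; ring.
Qed.

Lemma psd_schur (n k : nat) (Y : nat -> nat -> R) :
  psd n Y -> (k < n)%nat -> 0 < Y k k -> psd n (schur Y k).
Proof.
  intros HY Hk Hpos; split.
  - intros i j Hi Hj; unfold schur; rewrite (proj1 HY i j Hi Hj); unfold Rdiv; ring.
  - intros x; change (0 <= quad n (schur Y k) x); rewrite quad_schur.
    (* The minimizing t, where the polynomial takes the value of the Schur complement's form. *)
    pose proof (psd_shift_nonneg n k Y x (rsum n (fun j => x j * Y j k) / Y k k) HY Hk) as H.
    set (r := rsum n (fun j => x j * Y j k)) in *.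
    replace (quad n Y x - r ^ 2 / Y k k)
      with (quad n Y x - 2 * (r / Y k k) * r + (r / Y k k) ^ 2 * Y k k) by (field; lra).
    exact H.
Qed.

(* Symmetric elimination writes [Y] as a sum of rank-one matrices [y y^T], one per pivot. *)
Lemma psd_inner_nonneg (n : nat) (Q Y : nat -> nat -> R) :
  (forall x, 0 <= quad n Q x) -> psd n Y -> 0 <= dsum n (fun i j => Q i j * Y i j).
Proof.
  intros HQ.
  (* Induction on the number m of leading columns in which Y may be nonzero. The last of them is
     cleared by a Schur complement if its pivot is positive, and is already zero if its pivot
     vanishes. *)
  assert (H : forall m, (m <= n)%nat -> forall Y, psd n Y ->
    (forall i j, (i < n)%nat -> (j < n)%nat -> (m <= j)%nat -> Y i j = 0) ->
    0 <= dsum n (fun i j => Q i j * Y i j)).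
  { clear Y; induction m as [|m IH]; intros Hm Y HY Hz.
    - rewrite (dsum_ext n _ (fun _ _ => 0 * 0)); [rewrite dsum_scal; lra|].
      intros i j Hi Hj; rewrite Hz by lia; ring.
    - destruct (Rle_lt_or_eq_dec _ _ (psd_diag_nonneg n m Y HY Hm)) as [Hpos|H0].
      + assert (Hy : dsum n (fun i j => Q i j * Y i j) =
          dsum n (fun i j => Q i j * schur Y m i j) + / Y m m * quad n Q (fun i => Y i m)).
        { unfold quad; rewrite <- dsum_scal, <- dsum_plus; apply dsum_ext; intros.
          unfold schur; field; lra. }
        rewrite Hy; apply Rplus_le_le_0_compat.
        * apply IH; [lia|now apply psd_schur|].
          intros i j Hi Hj Hmj; unfold schur.
          destruct (Nat.eq_dec j m) as [->|Hn]; [field; lra|].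
          rewrite (Hz i j) by lia; rewrite (proj1 HY j m), (Hz m j) by lia; unfold Rdiv; ring.
        * apply Rmult_le_pos; [left; now apply Rinv_0_lt_compat|apply HQ].
      + apply IH; [lia|assumption|]; intros i j Hi Hj Hmj.
        destruct (Nat.eq_dec j m) as [->|Hn]; [|apply Hz; lia].
        now apply (psd_zero_diag n m i Y). }
  intros HY; apply (H n); auto; intros; lia.
Qed.

Lemma spin_sqr (s : nat -> bool) (i : nat) : spin s i * spin s i = 1.
Proof. unfold spin; destruct (s i); ring. Qed.

Lemma outer_feasible (n : nat) (s : nat -> bool) : sdp_feasible n (outer s).
Proof.
  split; [split|].
  - intros; unfold outer; ring.
  - intros x; change (0 <= dsum n (fun i j => x i * outer s i j * x j)); unfold outer.
    rewrite (dsum_ext n _ (fun i j => (x i * spin s i) * (x j * spin s j))) by (intros; ring).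
    rewrite dsum_prod; nra.
  - intros; apply spin_sqr.
Qed.

Lemma feasible_entry_le (n : nat) (s : nat -> bool) (Y : nat -> nat -> R) (i j : nat) :
  sdp_feasible n Y -> (i < n)%nat -> (j < n)%nat -> spin s i * spin s j * Y i j <= 1.
Proof.
  intros [HY Hd] Hi Hj.
  (* With unit diagonal this reads 0 <= 2 - 2 s_i s_j Y_ij. *)
  pose proof (psd_shift_nonneg n j Y (unit_vec i) (spin s i * spin s j) HY Hj) as H.
  rewrite quad_unit_vec, (rsum_unit_vec n i (fun k => Y k j)), !Hd in H by assumption.
  assert ((spin s i * spin s j) ^ 2 = 1)
    by (unfold spin; destruct (s i), (s j); ring).
  lra.
Qed.

Lemma quad_minus_kernel (n : nat) (Q : nat -> nat -> R) (x v : nat -> R) (t : R) :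
  (forall i j, Q i j = Q j i) ->
  (forall i, (i < n)%nat -> rsum n (fun j => Q i j * v j) = 0) ->
  quad n Q (fun i => x i - t * v i) = quad n Q x.
Proof.
  intros Hs Hv.
  assert (H0 : forall z, dsum n (fun i j => z i * (Q i j * v j)) = 0).
  { intros z; apply rsum_zero; intros i Hi; rewrite rsum_scal, Hv by assumption; ring. }
  unfold quad.
  rewrite (dsum_ext n _ (fun i j => x i * Q i j * x j - t * (x i * (Q i j * v j))
    - t * ((x j - t * v j) * (Q j i * v i)))) by (intros; rewrite (Hs j i); ring).
  rewrite !dsum_minus, !dsum_scal, H0.
  rewrite (dsum_swap n (fun i j => (x j - t * v j) * (Q j i * v i))).
  rewrite (H0 (fun i => x i - t * v i)); ring.
Qed.

Definition dual_diag (n : nat) (A : nat -> nat -> R) (lam : R) (s : nat -> bool) (i : nat) : R :=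
  rsum n (fun j => (A i j - lam) * spin s i * spin s j).

(* [S = diag d - A + lam J] annihilates the spin vector, so a spectral gap of [S] on its
   orthogonal complement gives [<S, Y> >= c (n - s^T Y s / n)] for all feasible [Y]. *)
Lemma unique_opt_of_gap (n : nat) (A : nat -> nat -> R) (lam c : R) (s : nat -> bool) :
  (forall i j, A i j = A j i) -> 0 < c -> (0 < n)%nat ->
  (forall x, rsum n (fun i => spin s i * x i) = 0 ->
     c * rsum n (fun i => x i ^ 2) <=
     rsum n (fun i => dual_diag n A lam s i * x i ^ 2) -
     dsum n (fun i j => (A i j - lam) * (x i * x j))) ->
  sdp_unique_opt n A lam (outer s).
Proof.
  intros Hsym Hc Hn Hgap; split; [apply outer_feasible|].
  intros Y HY Hobj.
  set (d := dual_diag n A lam s) in *.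
  assert (HN : 0 < INR n) by (apply lt_0_INR; lia).
  (* [Q] is S minus c times the orthogonal projection onto the complement of s. It still kills s, so
     its positivity need only be tested on that complement, where it is the assumed gap. *)
  set (Q := fun i j => (if Nat.eqb j i then d j - c else 0) - (A i j - lam)
                       + c / INR n * (spin s i * spin s j)).
  assert (HQ : forall x, quad n Q x =
    rsum n (fun i => d i * x i ^ 2) - dsum n (fun i j => (A i j - lam) * (x i * x j))
    - c * rsum n (fun i => x i ^ 2) + c / INR n * rsum n (fun i => spin s i * x i) ^ 2).
  { intros x; unfold quad, Q.
    rewrite (dsum_ext n _ (fun i j => ((if Nat.eqb j i then (d j - c) * x j ^ 2 else 0)
       - (A i j - lam) * (x i * x j)) + c / INR n * ((spin s i * x i) * (spin s j * x j)))).
    2: { intros i j _ _; destruct (Nat.eqb_spec j i) as [->|]; ring. }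
    rewrite dsum_plus, dsum_minus, dsum_scal, dsum_prod, (dsum_diag n (fun j => _)).
    rewrite (rsum_ext n (fun j => (d j - c) * x j ^ 2) (fun i => d i * x i ^ 2 - c * x i ^ 2))
      by (intros; ring).
    rewrite rsum_minus, rsum_scal; ring. }
  assert (HQpos : forall x, 0 <= quad n Q x).
  { intros x.
    set (t := rsum n (fun i => spin s i * x i) / INR n).
    set (y := fun i => x i - t * spin s i).
    assert (Hy : rsum n (fun i => spin s i * y i) = 0).
    { unfold y; rewrite (rsum_ext n _ (fun i => spin s i * x i - t * 1)).
      2: { intros; rewrite <- (spin_sqr s i); ring. }
      rewrite rsum_minus, rsum_const; unfold t; field; lra. }
    assert (Hx : quad n Q x = quad n Q y).
    { symmetry; apply quad_minus_kernel.
      - intros i j; unfold Q; rewrite (Hsym j i), (Nat.eqb_sym i j).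
        destruct (Nat.eqb_spec j i) as [->|]; ring.
      - intros i Hi; unfold Q.
        rewrite (rsum_ext n _ (fun j => (if Nat.eqb j i then (d j - c) * spin s j else 0)
          - spin s i * ((A i j - lam) * spin s i * spin s j) + c / INR n * spin s i)).
        2: { intros j _.
             pose proof (spin_sqr s i) as Hsi; pose proof (spin_sqr s j) as Hsj.
             replace (spin s i * ((A i j - lam) * spin s i * spin s j))
               with ((spin s i * spin s i) * ((A i j - lam) * spin s j)) by ring.
             replace (c / INR n * spin s i)
               with (c / INR n * spin s i * (spin s j * spin s j)) by (rewrite Hsj; ring).
             rewrite Hsi; destruct (Nat.eqb_spec j i) as [->|]; ring. }
        rewrite rsum_plus, rsum_minus, rsum_delta, rsum_scal, rsum_const by assumption.
        fold (dual_diag n A lam s i); fold d; field; lra. }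
    rewrite Hx, HQ, Hy; specialize (Hgap y Hy); lra. }
  pose proof (psd_inner_nonneg n Q Y HQpos (proj1 HY)) as Hin.
  assert (HQY : dsum n (fun i j => Q i j * Y i j) =
    rsum n d - c * INR n - sdp_obj n A lam Y
    + c / INR n * dsum n (fun i j => spin s i * spin s j * Y i j)).
  { unfold Q, sdp_obj; fold (dsum n (fun i j => (A i j - lam) * Y i j)).
    rewrite (dsum_ext n _ (fun i j => (if Nat.eqb j i then d j - c else 0)
       - (A i j - lam) * Y i j + c / INR n * (spin s i * spin s j * Y i j))).
    2: { intros i j Hi _; destruct (Nat.eqb_spec j i) as [->|]; [rewrite (proj2 HY i Hi)|]; ring. }
    rewrite dsum_plus, dsum_minus, dsum_scal, (dsum_diag n (fun j => d j - c)).
    rewrite rsum_minus, rsum_const; ring. }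
  assert (Hopt : sdp_obj n A lam (outer s) = rsum n d).
  { unfold sdp_obj, d, dual_diag, outer; apply rsum_ext; intros; apply rsum_ext; intros; ring. }
  (* Entries of [D] are nonnegative for every feasible [Y]. Optimality together with <Q, Y> >= 0
     forces their sum to be at most 0, so all of them vanish. *)
  set (D := fun i j => 1 - spin s i * spin s j * Y i j).
  assert (HD : dsum n D <= 0).
  { unfold D; rewrite dsum_minus; unfold dsum at 1; rewrite !rsum_const.
    assert (c / INR n * (INR n * (INR n * 1) - dsum n (fun i j => spin s i * spin s j * Y i j)) <= 0).
    { replace (c / INR n * (INR n * (INR n * 1) - dsum n (fun i j => spin s i * spin s j * Y i j)))
        with (c * INR n - c / INR n * dsum n (fun i j => spin s i * spin s j * Y i j))
        by (field; lra). lra. }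
    assert (0 < c / INR n) by (apply Rdiv_lt_0_compat; lra); nra. }
  assert (HDpos : forall i j, (i < n)%nat -> (j < n)%nat -> 0 <= D i j).
  { intros i j Hi Hj; unfold D; pose proof (feasible_entry_le n s Y i j HY Hi Hj); lra. }
  intros i j Hi Hj.
  assert (D i j <= dsum n D).
  { apply Rle_trans with (rsum n (fun j => D i j)).
    - apply (rsum_term_le n j (fun j => D i j)); auto.
    - apply (rsum_term_le n i (fun i => rsum n (fun j => D i j))); auto.
      intros; apply rsum_nonneg; auto. }
  pose proof (HDpos i j Hi Hj) as Hij.
  assert (E : spin s i * spin s j * Y i j = 1) by (unfold D in *; lra).
  unfold outer; revert E; unfold spin; destruct (s i), (s j); lra.
Qed.

(** * Quadratic forms of sparse noise *)

Definition indicator (S : nat -> bool) (i : nat) : R := if S i then 1 else 0.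

Lemma filter_length_lt {T : Type} (p q : T -> bool) (l : list T) (x : T) :
  (forall y, p y = true -> q y = true) -> In x l -> q x = true -> p x = false ->
  (length (filter p l) < length (filter q l))%nat.
Proof.
  intros Hpq Hx Hq Hp.
  assert (Hle : forall m, (length (filter p m) <= length (filter q m))%nat).
  { induction m as [|y m IH]; simpl; [lia|].
    destruct (p y) eqn:E; [rewrite (Hpq y E); simpl; lia|].
    destruct (q y); simpl; lia. }
  induction l as [|y l IH]; [easy|]; destruct Hx as [->|Hx]; simpl.
  - rewrite Hp, Hq; simpl; specialize (Hle l); lia.
  - specialize (IH Hx); destruct (p y) eqn:E; [rewrite (Hpq y E); simpl; lia|].
    destruct (q y); simpl; lia.
Qed.

Lemma exists_argmin {T : Type} (l : list T) (f : T -> R) :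
  l <> [] -> exists x, In x l /\ forall y, In y l -> f x <= f y.
Proof.
  induction l as [|x l IH]; intros H; [easy|].
  destruct l as [|x' l'].
  - exists x; split; [simpl; auto|]; intros y [->|[]]; lra.
  - destruct IH as [z [Hz Hmin]]; [easy|].
    destruct (Rle_dec (f x) (f z)) as [Hle|Hle].
    + exists x; split; [simpl; auto|]; intros y [->|Hy]; [lra|].
      specialize (Hmin y Hy); lra.
    + exists z; split; [simpl; auto|]; intros y [->|Hy]; [lra|auto].
Qed.

(* Layer cake: [min (y i) (y j)] is a positive combination of the products
   [1_S(i) 1_S(j)] over the superlevel sets [S] of [y]. *)
Lemma dsum_min_le (n : nat) (B : nat -> nat -> R) (D : R) (T : nat -> bool) :
  (forall S : nat -> bool, (forall i, S i = true -> T i = true) ->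
     dsum n (fun i j => B i j * (indicator S i * indicator S j)) <= D * rsum n (indicator S)) ->
  forall y, (forall i, 0 <= y i) -> (forall i, T i = false -> y i = 0) ->
    dsum n (fun i j => B i j * Rmin (y i) (y j)) <= D * rsum n y.
Proof.
  intros HB.
  set (pos := fun (y : nat -> R) i => if Rlt_dec 0 (y i) then true else false).
  assert (H : forall m y, (length (filter (pos y) (seq 0 n)) < m)%nat ->
    (forall i, 0 <= y i) -> (forall i, T i = false -> y i = 0) ->
    dsum n (fun i j => B i j * Rmin (y i) (y j)) <= D * rsum n y).
  { induction m as [|m IH]; intros y Hm Hy HT; [lia|].
    destruct (list_eq_dec Nat.eq_dec (filter (pos y) (seq 0 n)) []) as [Hnil|Hne].
    - assert (Hz : forall i, (i < n)%nat -> y i = 0).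
      { intros i Hi; destruct (pos y i) eqn:E.
        - assert (Hin : In i (filter (pos y) (seq 0 n)))
            by (apply filter_In; split; [apply in_seq; lia|assumption]).
          rewrite Hnil in Hin; easy.
        - unfold pos in E; destruct (Rlt_dec 0 (y i)); [discriminate|].
          specialize (Hy i); lra. }
      rewrite (rsum_zero n y Hz).
      rewrite (dsum_ext n _ (fun _ _ => 0 * 0)); [rewrite dsum_scal; lra|].
      intros i j Hi Hj; rewrite (Hz i), (Hz j), Rmin_left by (assumption || lra); ring.
    - destruct (exists_argmin _ y Hne) as [k [Hk Hmin]].
      apply filter_In in Hk; destruct Hk as [Hk Hposk].
      set (y' := fun i => y i - y k * indicator (pos y) i).
      assert (Hyk : 0 < y k)
        by (unfold pos in Hposk; destruct (Rlt_dec 0 (y k)); [assumption|discriminate]).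
      (* Removes the lowest layer, of height [y k]. The value 0 beyond n is needed because
         minimality of [y k] is known only for indices below n, while the induction asks for
         nonnegativity everywhere. *)
      set (z := fun i => if pos y i then if (i <? n)%nat then y' i else 0 else 0).
      assert (Hz : forall i, (i < n)%nat -> z i = y i - y k * indicator (pos y) i).
      { intros i Hi; unfold z, y', indicator.
        apply Nat.ltb_lt in Hi; rewrite Hi; destruct (pos y i) eqn:E; [reflexivity|].
        unfold pos in E; destruct (Rlt_dec 0 (y i)); [discriminate|]; specialize (Hy i); lra. }
      assert (Hz0 : forall i, 0 <= z i).
      { intros i; unfold z; destruct (pos y i) eqn:E; [|lra].
        destruct (Nat.ltb_spec i n) as [Hi|]; [|lra].
        unfold y', indicator; rewrite E.
        assert (y k <= y i)
          by (apply Hmin, filter_In; split; [apply in_seq; lia|assumption]); lra. }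
      rewrite (dsum_ext n _ (fun i j => B i j * Rmin (z i) (z j) +
        y k * (B i j * (indicator (pos y) i * indicator (pos y) j)))).
      2: { intros i j Hi Hj; pose proof (Hz0 i); pose proof (Hz0 j).
           rewrite <- Rmult_assoc, (Rmult_comm (y k)), Rmult_assoc, <- Rmult_plus_distr_l; f_equal.
           assert (Ei : z i = y i - y k * indicator (pos y) i) by auto.
           assert (Ej : z j = y j - y k * indicator (pos y) j) by auto.
           unfold indicator in *.
           assert (Hpi : pos y i = false -> y i = 0).
           { unfold pos; destruct (Rlt_dec 0 (y i)); [discriminate|]; specialize (Hy i); lra. }
           assert (Hpj : pos y j = false -> y j = 0).
           { unfold pos; destruct (Rlt_dec 0 (y j)); [discriminate|]; specialize (Hy j); lra. }
           pose proof (Hy i); pose proof (Hy j).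
           destruct (pos y i), (pos y j); try specialize (Hpi eq_refl); try specialize (Hpj eq_refl);
             unfold Rmin; destruct (Rle_dec (z i) (z j)), (Rle_dec (y i) (y j)); lra. }
      rewrite dsum_plus, dsum_scal.
      assert (Hsum : rsum n y = rsum n z + y k * rsum n (indicator (pos y))).
      { rewrite <- rsum_scal, <- rsum_plus; apply rsum_ext; intros i Hi; rewrite Hz by auto; ring. }
      rewrite Hsum.
      assert (H1 : dsum n (fun i j => B i j * Rmin (z i) (z j)) <= D * rsum n z).
      { apply IH; [|assumption|].
        - apply Nat.lt_le_trans with (length (filter (pos y) (seq 0 n))); [|lia].
          apply filter_length_lt with k; auto.
          + intros i; unfold pos at 1; destruct (Rlt_dec 0 (z i)) as [Hzi|]; [|discriminate].
            intros _; unfold z in Hzi; destruct (pos y i); [reflexivity|lra].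
          + unfold pos; destruct (Rlt_dec 0 (z k)) as [Hzk|]; [|reflexivity].
            rewrite Hz in Hzk by (apply in_seq in Hk; lia).
            unfold indicator in Hzk; rewrite Hposk in Hzk; lra.
        - intros i Hi; unfold z; unfold pos; destruct (Rlt_dec 0 (y i)); [|reflexivity].
          rewrite HT in *; auto; lra. }
      assert (H2 : dsum n (fun i j => B i j * (indicator (pos y) i * indicator (pos y) j))
                   <= D * rsum n (indicator (pos y))).
      { apply HB; intros i Hi; destruct (T i) eqn:E; [reflexivity|].
        unfold pos in Hi; rewrite (HT i E) in Hi; destruct (Rlt_dec 0 0); [lra|discriminate]. }
      nra. }
  intros y; apply (H (S (length (filter (pos y) (seq 0 n))))); lia.
Qed.

Definition is_sign (u : nat -> R) : Prop := forall i, u i = 1 \/ u i = -1.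

Lemma rsum_le_sign (n : nat) (z r : nat -> R) :
  (forall i, Rabs (z i) <= 1) ->
  exists u, is_sign u /\ rsum n (fun i => z i * r i) <= rsum n (fun i => u i * r i) /\
    rsum n (fun i => Rabs (r i)) = rsum n (fun i => u i * r i).
Proof.
  intros Hz; exists (fun i => if Rle_dec 0 (r i) then 1 else -1); split; [|split].
  - intros i; destruct (Rle_dec 0 (r i)); auto.
  - apply rsum_le; intros i _; specialize (Hz i); pose proof (Rle_abs (z i)).
    pose proof (Rle_abs (- z i)) as Hz'.
    rewrite Rabs_Ropp in Hz'.
    destruct (Rle_dec 0 (r i)); nra.
  - apply rsum_ext; intros i _; destruct (Rle_dec 0 (r i)).
    + rewrite Rabs_pos_eq by lra; ring.
    + rewrite Rabs_left by lra; ring.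
Qed.

(** The form is linear in each argument, and a linear form on the box is maximal at a sign vector;
    [z] is rounded first with [w] fixed, then [w]. *)
Lemma bilinear_box_le (n : nat) (M : nat -> nat -> R) (t : R) :
  (forall u v, is_sign u -> is_sign v -> dsum n (fun i j => M i j * (u i * v j)) <= t) ->
  forall z w, (forall i, Rabs (z i) <= 1) -> (forall i, Rabs (w i) <= 1) ->
    dsum n (fun i j => M i j * (z i * w j)) <= t.
Proof.
  intros HM z w Hz Hw.
  destruct (rsum_le_sign n z (fun i => rsum n (fun j => M i j * w j)) Hz) as [u [Hu [Hzu _]]].
  destruct (rsum_le_sign n w (fun j => rsum n (fun i => M i j * u i)) Hw) as [v [Hv [Hwv _]]].
  assert (E1 : forall a b, dsum n (fun i j => M i j * (a i * b j)) =
    rsum n (fun i => a i * rsum n (fun j => M i j * b j))).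
  { intros a b; apply rsum_ext; intros; rewrite <- rsum_scal; apply rsum_ext; intros; ring. }
  assert (E2 : forall a b, dsum n (fun i j => M i j * (a i * b j)) =
    rsum n (fun j => b j * rsum n (fun i => M i j * a i))).
  { intros a b; rewrite dsum_swap; apply rsum_ext; intros.
    rewrite <- rsum_scal; apply rsum_ext; intros; ring. }
  specialize (HM u v Hu Hv).
  rewrite E1 in *; eapply Rle_trans; [exact Hzu|].
  rewrite <- E1 in *; rewrite E2 in *; lra.
Qed.

(** Test the cut norm with the signs of M v. Taken at the spin vector, this controls the total
    deviation of the dual diagonal from its mean. *)
Lemma rsum_abs_rows_le (n : nat) (M : nat -> nat -> R) (v : nat -> R) (t : R) :
  (forall u v, is_sign u -> is_sign v -> dsum n (fun i j => M i j * (u i * v j)) <= t) ->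
  is_sign v -> rsum n (fun i => Rabs (rsum n (fun j => M i j * v j))) <= t.
Proof.
  intros HM Hv.
  destruct (rsum_le_sign n (fun _ => 0) (fun i => rsum n (fun j => M i j * v j)))
    as [u [Hu [_ E]]]; [intros; rewrite Rabs_R0; lra|].
  rewrite E; eapply Rle_trans; [|exact (HM u v Hu Hv)].
  right; apply rsum_ext; intros; rewrite <- rsum_scal; apply rsum_ext; intros; ring.
Qed.

(** If both numbers are at least 1, expand (r a - b)^2 >= 0 with a the smaller one; the squared
    minimum will be paid for by sparsity of small sets. If one is below 1, the other exceeds r, so
    their ratio does too, and the degree term suffices. *)
Lemma mult_le_truncated (r u v : R) :
  1 < r -> 0 <= u -> 0 <= v -> r < u \/ r < v ->
  u * v <= r / 2 * Rmin (if Rle_dec 1 u then u ^ 2 else 0) (if Rle_dec 1 v then v ^ 2 else 0)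
           + / r * (u ^ 2 + v ^ 2).
Proof.
  intros Hr Hu Hv Hl.
  assert (Hri : 0 < / r) by (apply Rinv_0_lt_compat; lra).
  assert (Hrr : r * / r = 1) by (apply Rinv_r; lra).
  assert (Hsq : forall w, 0 <= / r * w ^ 2)
    by (intros; apply Rmult_le_pos; [lra|apply pow2_ge_0]).
  assert (Havg : forall a b, a * b <= r / 2 * a ^ 2 + / r * (a ^ 2 + b ^ 2)).
  { intros a b; pose proof (Hsq (r * a - b)); pose proof (Hsq a); pose proof (Hsq b).
    replace (/ r * (r * a - b) ^ 2) with (r * a ^ 2 - 2 * (a * b) + / r * b ^ 2) in * by (field; lra).
    lra. }
  assert (Hone : forall a b, 0 <= b < 1 -> r < a -> a * b <= / r * (a ^ 2 + b ^ 2)).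
  { intros a b Hb Ha; apply Rmult_le_reg_l with r; [lra|].
    rewrite <- (Rmult_assoc r (/ r)), Hrr.
    assert (r * b <= a) by nra; replace (r * (a * b)) with (a * (r * b)) by ring; nra. }
  destruct (Rle_dec 1 u), (Rle_dec 1 v).
  - unfold Rmin; destruct Rle_dec; [apply Havg|].
    rewrite (Rmult_comm u), (Rplus_comm (u ^ 2)); apply Havg.
  - rewrite Rmin_right by apply pow2_ge_0; pose proof (Hone u v ltac:(lra) ltac:(lra)); lra.
  - rewrite Rmin_left by apply pow2_ge_0; pose proof (Hone v u ltac:(lra) ltac:(lra)); lra.
  - lra.
Qed.

Lemma mult_le_large (r u v : R) :
  1 < r -> 0 <= u -> 0 <= v -> r < u \/ r < v ->
  u * v <= / r * ((u ^ 2 * (1 + v ^ 2) + (1 + u ^ 2) * v ^ 2) / 2).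
Proof.
  intros Hr Hu Hv Hl; apply Rmult_le_reg_l with r; [lra|].
  rewrite <- (Rmult_assoc r (/ r)), Rinv_r, Rmult_1_l by lra.
  assert (H : forall a b, 0 <= b -> r < a -> r * (a * b) <= a ^ 2 * ((1 + b ^ 2) / 2)).
  { intros a b Hb Ha; assert (b <= (1 + b ^ 2) / 2) by (pose proof (pow2_ge_0 (1 - b)); lra).
    apply Rle_trans with (a ^ 2 * b); [|apply Rmult_le_compat_l; [apply pow2_ge_0|assumption]].
    replace (a ^ 2 * b) with (a * (a * b)) by ring.
    apply Rmult_le_compat_r; [apply Rmult_le_pos|]; lra. }
  pose proof (pow2_ge_0 u); pose proof (pow2_ge_0 v).
  assert (0 <= u ^ 2 * v ^ 2) by (apply Rmult_le_pos; assumption).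
  destruct Hl as [Hl|Hl]; [pose proof (H u v Hv Hl)|pose proof (H v u Hu Hl)]; lra.
Qed.

Lemma dsum_sqr_sum (n : nat) (B : nat -> nat -> R) (C : R) (x : nat -> R) :
  (forall i j, B i j = B j i) -> (forall i, (i < n)%nat -> rsum n (fun j => B i j) <= C) ->
  dsum n (fun i j => B i j * (x i ^ 2 + x j ^ 2)) <= 2 * C * rsum n (fun i => x i ^ 2).
Proof.
  intros Hs HC.
  rewrite (dsum_ext n _ (fun i j => x i ^ 2 * B i j + x j ^ 2 * B j i))
    by (intros i j _ _; rewrite (Hs j i); ring).
  rewrite dsum_plus, <- (dsum_swap n (fun i j => x i ^ 2 * B i j)).
  assert (dsum n (fun i j => x i ^ 2 * B i j) <= C * rsum n (fun i => x i ^ 2)); [|lra].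
  rewrite <- rsum_scal; apply rsum_le; intros i Hi; rewrite rsum_scal, Rmult_comm.
  apply Rmult_le_compat_r; [apply pow2_ge_0|auto].
Qed.

(* Coordinates of size at most [r] are controlled by the cut norm.  In the other pairs either
   both coordinates are at least [1], hence supported on few vertices where sparsity of small
   sets applies, or their ratio exceeds [r] and the degree bound suffices. *)
Lemma noise_quad_bound_scaled (n : nat) (A P : nat -> nat -> R) (p C D delta t r : R) (x : nat -> R) :
  (forall i j, A i j = A j i) -> (forall i j, 0 <= A i j) -> (forall i j, 0 <= P i j <= p) ->
  (forall u v, is_sign u -> is_sign v -> dsum n (fun i j => (A i j - P i j) * (u i * v j)) <= t) ->
  (forall i, (i < n)%nat -> rsum n (fun j => A i j) <= C) ->
  (forall S, rsum n (indicator S) <= delta * INR n ->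
     dsum n (fun i j => A i j * (indicator S i * indicator S j)) <= D * rsum n (indicator S)) ->
  delta <= 1 -> 1 < r -> 0 <= D -> rsum n (fun i => x i ^ 2) <= delta * INR n ->
  quad n (fun i j => A i j - P i j) x <=
    r ^ 2 * t + (r / 2 * D + 2 * C / r + 2 * p * INR n / r) * rsum n (fun i => x i ^ 2).
Proof.
  intros HAs HA HP Ht HC HD Hdelta Hr HDpos Hx.
  set (N := rsum n (fun i => x i ^ 2)) in *.
  assert (Hri : 0 < / r) by (apply Rinv_0_lt_compat; lra).
  assert (HN : 0 <= N) by (apply rsum_nonneg; intros; apply pow2_ge_0).
  pose proof (pos_INR n) as Hn0.
  (* [z] is the part of size at most r, rescaled into the unit box for the cut norm; [y] keeps the
     squares of the coordinates of size at least 1, for the layer cake bound. *)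
  set (z := fun i => if Rle_dec (Rabs (x i)) r then x i / r else 0).
  set (y := fun i => if Rle_dec 1 (Rabs (x i)) then if (i <? n)%nat then x i ^ 2 else 0 else 0).
  assert (Hz : forall i, Rabs (z i) <= 1).
  { intros i; unfold z; destruct Rle_dec as [Hi|]; [|rewrite Rabs_R0; lra].
    unfold Rdiv; rewrite Rabs_mult, (Rabs_pos_eq (/ r)) by lra.
    apply Rmult_le_reg_r with r; [lra|]; rewrite Rmult_assoc, Rinv_l by lra; lra. }
  assert (Hbox := bilinear_box_le n (fun i j => A i j - P i j) t Ht z z Hz Hz).
  set (Q := fun i j => p / r * ((x i ^ 2 * (1 + x j ^ 2) + (1 + x i ^ 2) * x j ^ 2) / 2)).
  assert (Hpt : forall i j, (i < n)%nat -> (j < n)%nat ->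
    x i * (A i j - P i j) * x j <= r ^ 2 * ((A i j - P i j) * (z i * z j))
      + (r / 2 * (A i j * Rmin (y i) (y j)) + / r * (A i j * (x i ^ 2 + x j ^ 2))) + Q i j).
  { intros i j Hi Hj; specialize (HA i j); specialize (HP i j).
    pose proof (pow2_ge_0 (x i)); pose proof (pow2_ge_0 (x j)).
    assert (Hyi : 0 <= y i) by (unfold y; destruct Rle_dec, (i <? n)%nat; lra).
    assert (Hyj : 0 <= y j) by (unfold y; destruct Rle_dec, (j <? n)%nat; lra).
    assert (Hm : 0 <= Rmin (y i) (y j)) by (apply Rmin_glb; assumption).
    assert (HQ : 0 <= Q i j).
    { unfold Q; apply Rmult_le_pos; [apply Rmult_le_pos; lra|nra]. }
    assert (Hrest : 0 <= r / 2 * (A i j * Rmin (y i) (y j)) + / r * (A i j * (x i ^ 2 + x j ^ 2))).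
    { apply Rplus_le_le_0_compat; apply Rmult_le_pos; try lra; apply Rmult_le_pos; lra. }
    destruct (Rle_dec (Rabs (x i)) r) as [Hxir|Hxir];
      [destruct (Rle_dec (Rabs (x j)) r) as [Hxjr|Hxjr]|].
    1: { assert (E : r ^ 2 * ((A i j - P i j) * (z i * z j)) = x i * (A i j - P i j) * x j).
         { unfold z; destruct (Rle_dec (Rabs (x i)) r); [|contradiction].
           destruct (Rle_dec (Rabs (x j)) r); [|contradiction]; field; lra. }
         lra. }
    all: assert (Ez : z i * z j = 0)
      by (unfold z; destruct (Rle_dec (Rabs (x i)) r), (Rle_dec (Rabs (x j)) r); try contradiction; ring).
    all: rewrite Ez.
    all: assert (Hlarge : r < Rabs (x i) \/ r < Rabs (x j)) by lra.
    all: assert (Habs : x i * (A i j - P i j) * x j <=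
           A i j * (Rabs (x i) * Rabs (x j)) + P i j * (Rabs (x i) * Rabs (x j)))
      by (pose proof (Rle_abs (x i * x j)); pose proof (Rle_abs (- (x i * x j)));
          rewrite Rabs_Ropp in *; rewrite <- Rabs_mult; nra).
    all: assert (HAij := mult_le_truncated r _ _ Hr (Rabs_pos (x i)) (Rabs_pos (x j)) Hlarge).
    all: assert (HPij := mult_le_large r _ _ Hr (Rabs_pos (x i)) (Rabs_pos (x j)) Hlarge).
    all: rewrite !pow2_abs in HAij, HPij.
    all: assert (Ei : y i = if Rle_dec 1 (Rabs (x i)) then x i ^ 2 else 0)
      by (apply Nat.ltb_lt in Hi; unfold y; now rewrite Hi).
    all: assert (Ej : y j = if Rle_dec 1 (Rabs (x j)) then x j ^ 2 else 0)
      by (apply Nat.ltb_lt in Hj; unfold y; now rewrite Hj).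
    all: rewrite <- Ei, <- Ej in HAij.
    all: assert (HP2 : P i j * (Rabs (x i) * Rabs (x j)) <= Q i j)
      by (unfold Q, Rdiv at 1; rewrite Rmult_assoc;
          pose proof (Rabs_pos (x i)); pose proof (Rabs_pos (x j));
          apply Rmult_le_compat; try lra; apply Rmult_le_pos; lra).
    all: assert (HA2 : A i j * (Rabs (x i) * Rabs (x j)) <=
           A i j * (r / 2 * Rmin (y i) (y j) + / r * (x i ^ 2 + x j ^ 2)))
      by (apply Rmult_le_compat_l; lra).
    all: lra. }
  assert (Hsum := dsum_le n _ _ Hpt); cbn beta in Hsum.
  rewrite !dsum_plus, !dsum_scal in Hsum.
  (* By Chebyshev, at most N <= delta n coordinates have size at least 1, so every superlevel set of
     [y] is small enough for the sparsity hypothesis. *)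
  assert (Hmin : dsum n (fun i j => A i j * Rmin (y i) (y j)) <= D * N).
  { set (T := fun i => if Rle_dec 1 (Rabs (x i)) then (i <? n)%nat else false).
    assert (HyN : rsum n y <= N).
    { apply rsum_le; intros i _; unfold y; pose proof (pow2_ge_0 (x i)).
      destruct Rle_dec, (i <? n)%nat; lra. }
    eapply Rle_trans; [apply (dsum_min_le n A D T)|].
    - intros S HS; apply HD.
      apply Rle_trans with N; [|lra]; apply rsum_le; intros i _; unfold indicator.
      pose proof (pow2_ge_0 (x i)).
      destruct (S i) eqn:E; [|lra]; apply HS in E; unfold T in E.
      destruct Rle_dec as [H1|]; [|discriminate]; rewrite <- pow2_abs; nra.
    - intros i; unfold y; pose proof (pow2_ge_0 (x i)); destruct Rle_dec, (i <? n)%nat; lra.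
    - intros i; unfold T, y; destruct Rle_dec, (i <? n)%nat; easy.
    - nra. }
  assert (Hdeg := dsum_sqr_sum n A C x HAs HC); fold N in Hdeg.
  assert (HQ : dsum n Q <= 2 * p * INR n / r * N).
  { unfold Q; rewrite dsum_scal.
    rewrite (dsum_ext n _ (fun i j => / 2 * (x i ^ 2 * (1 + x j ^ 2) + (1 + x i ^ 2) * x j ^ 2)))
      by (intros; field).
    rewrite dsum_scal, dsum_plus, !(dsum_prod n (fun i => _) (fun j => _)).
    rewrite rsum_plus, rsum_const; fold N.
    assert (Hp : 0 <= p) by (specialize (HP O O); lra).
    replace (2 * p * INR n / r * N) with (p / r * (2 * INR n * N)) by (field; lra).
    (* The normalization N <= delta n with delta <= 1 turns N (n + N) into at most 2 n N. *)
    assert (HNn : N <= INR n) by nra.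
    assert (N * N <= INR n * N) by (apply Rmult_le_compat_r; assumption).
    apply Rmult_le_compat_l; [apply Rmult_le_pos; lra|]; lra. }
  unfold quad; eapply Rle_trans; [exact Hsum|].
  assert (r ^ 2 * dsum n (fun i j => (A i j - P i j) * (z i * z j)) <= r ^ 2 * t)
    by (apply Rmult_le_compat_l; [apply pow2_ge_0|assumption]).
  assert (r / 2 * dsum n (fun i j => A i j * Rmin (y i) (y j)) <= r / 2 * (D * N))
    by (apply Rmult_le_compat_l; lra).
  assert (/ r * dsum n (fun i j => A i j * (x i ^ 2 + x j ^ 2)) <= / r * (2 * C * N))
    by (apply Rmult_le_compat_l; lra).
  unfold Rdiv in *; lra.
Qed.

(** The cut-offs 1 and r are absolute, so [x] is first rescaled. Taking |x|^2 equal to delta n, the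
    largest value allowed, makes the additive term r^2 t as small as possible relative to |x|^2. *)
Lemma noise_quad_bound (n : nat) (A P : nat -> nat -> R) (p C D delta t r : R) (x : nat -> R) :
  (forall i j, A i j = A j i) -> (forall i j, 0 <= A i j) -> (forall i j, 0 <= P i j <= p) ->
  (forall u v, is_sign u -> is_sign v -> dsum n (fun i j => (A i j - P i j) * (u i * v j)) <= t) ->
  (forall i, (i < n)%nat -> rsum n (fun j => A i j) <= C) ->
  (forall S, rsum n (indicator S) <= delta * INR n ->
     dsum n (fun i j => A i j * (indicator S i * indicator S j)) <= D * rsum n (indicator S)) ->
  0 < delta <= 1 -> 1 < r -> 0 <= D -> (0 < n)%nat ->
  quad n (fun i j => A i j - P i j) x <=
    (r ^ 2 * t / (delta * INR n) + r / 2 * D + 2 * C / r + 2 * p * INR n / r)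
    * rsum n (fun i => x i ^ 2).
Proof.
  intros HAs HA HP Ht HC HD Hdelta Hr HDpos Hn.
  assert (HN : 0 < INR n) by (apply lt_0_INR; lia).
  assert (HM : 0 < delta * INR n) by nra.
  set (N := rsum n (fun i => x i ^ 2)).
  assert (HN0 : 0 <= N) by (apply rsum_nonneg; intros; apply pow2_ge_0).
  destruct (Rle_lt_or_eq_dec _ _ HN0) as [Hpos|H0].
  - set (k := sqrt (delta * INR n / N)).
    assert (Hk : k ^ 2 = delta * INR n / N)
      by (unfold k; rewrite pow2_sqrt; [reflexivity|left; now apply Rdiv_lt_0_compat]).
    assert (Hkx : rsum n (fun i => (k * x i) ^ 2) = delta * INR n).
    { rewrite (rsum_ext n _ (fun i => k ^ 2 * x i ^ 2)) by (intros; ring).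
      rewrite rsum_scal; fold N; rewrite Hk; field; lra. }
    pose proof (noise_quad_bound_scaled n A P p C D delta t r (fun i => k * x i)
      HAs HA HP Ht HC HD ltac:(lra) Hr HDpos (Req_le _ _ Hkx)) as H; cbn beta in H.
    rewrite Hkx in H.
    assert (E : quad n (fun i j => A i j - P i j) (fun i => k * x i) =
                delta * INR n / N * quad n (fun i j => A i j - P i j) x).
    { rewrite <- Hk; unfold quad; rewrite <- dsum_scal; apply dsum_ext; intros; ring. }
    rewrite E in H.
    apply Rmult_le_reg_l with (delta * INR n / N); [now apply Rdiv_lt_0_compat|].
    eapply Rle_trans; [exact H|right; field; lra].
  - assert (Hx : forall i, (i < n)%nat -> x i = 0).
    { intros i Hi.
      assert (x i ^ 2 <= N)
        by (apply (rsum_term_le n i (fun i => x i ^ 2)); [intros; apply pow2_ge_0|assumption]).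
      nra. }
    unfold quad; rewrite (dsum_ext n _ (fun _ _ => 0 * 0)).
    + rewrite dsum_scal; rewrite <- H0; lra.
    + intros i j Hi _; rewrite (Hx i Hi); ring.
Qed.

(** * Sums of inverse degrees *)

Lemma sqr_rsum_le_weighted (n : nat) (d x : nat -> R) :
  (forall i, (i < n)%nat -> 0 < d i) ->
  rsum n x ^ 2 <= rsum n (fun i => d i * x i ^ 2) * rsum n (fun i => / d i).
Proof.
  intros Hd.
  destruct n as [|n]; [simpl; lra|].
  set (w := rsum (S n) (fun i => / d i)).
  assert (Hw : 0 < w).
  { apply Rlt_le_trans with (/ d O); [apply Rinv_0_lt_compat, Hd; lia|].
    apply (rsum_term_le (S n) O (fun i => / d i)); [|lia].
    intros i Hi; left; now apply Rinv_0_lt_compat, Hd. }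
  set (s := rsum (S n) x).
  (* Weighted Cauchy-Schwarz: equality holds for x proportional to 1/d, and s/w is the coefficient
     matching the sum of [x]. *)
  assert (H : 0 <= rsum (S n) (fun i => d i * (x i - s / w * / d i) ^ 2)).
  { apply rsum_nonneg; intros i Hi; apply Rmult_le_pos; [left; auto|apply pow2_ge_0]. }
  rewrite (rsum_ext _ _ (fun i => d i * x i ^ 2 - 2 * (s / w) * x i + (s / w) ^ 2 * / d i)) in H.
  2: { intros i Hi; specialize (Hd i Hi); field; lra. }
  rewrite rsum_plus, rsum_minus, !rsum_scal in H; fold s w in H.
  assert (E : (s / w) ^ 2 * w = s ^ 2 / w /\ s / w * s = s ^ 2 / w) by (split; field; lra).
  destruct E as [E1 E2].
  apply Rmult_le_reg_r with (/ w); [now apply Rinv_0_lt_compat|].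
  rewrite (Rmult_assoc _ w), Rinv_r by lra; unfold Rdiv in *; lra.
Qed.

(** From 1/d - 1/m = (m - d)/(d m). Only the total deviation matters; a single degree may be far
    from its mean as long as it stays above [e]. *)
Lemma rsum_inv_perturb (n : nat) (d m : nat -> R) (e g : R) :
  0 < e -> 0 < g -> (forall i, (i < n)%nat -> e <= d i) -> (forall i, (i < n)%nat -> g <= m i) ->
  rsum n (fun i => / d i) <=
    rsum n (fun i => / m i) + / (e * g) * rsum n (fun i => Rabs (d i - m i)).
Proof.
  intros He Hg Hd Hm; rewrite <- rsum_scal, <- rsum_plus; apply rsum_le; intros i Hi.
  specialize (Hd i Hi); specialize (Hm i Hi).
  assert (E : / d i = / m i + / (d i * m i) * (m i - d i)) by (field; lra).
  rewrite E; apply Rplus_le_compat_l.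
  apply Rle_trans with (/ (d i * m i) * Rabs (d i - m i)).
  - apply Rmult_le_compat_l; [left; apply Rinv_0_lt_compat; nra|].
    rewrite Rabs_minus_sym; apply Rle_abs.
  - apply Rmult_le_compat_r; [apply Rabs_pos|].
    apply Rinv_le_contravar; nra.
Qed.

Definition same (s : nat -> bool) (i j : nat) : bool := Bool.eqb (s i) (s j).

(** Up to the factor w, the row sum of (P_ij - lam) s_i s_j, that is, [dual_diag] with [P] in place
    of [A]. *)
Definition mean_degree (n : nat) (s : nat -> bool) (al be : R) (i : nat) : R :=
  rsum n (fun j => if same s i j then al else be).

Lemma rsum_indicator_bool (n : nat) (s : nat -> bool) (u v : R) :
  rsum n (fun i => if s i then u else v) =
  rsum n (indicator s) * u + (INR n - rsum n (indicator s)) * v.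
Proof.
  rewrite (rsum_ext n _ (fun i => indicator s i * u + (1 - indicator s i) * v)).
  - rewrite rsum_plus, !rsum_scal_r, rsum_minus, rsum_const; ring.
  - intros i _; unfold indicator; destruct (s i); ring.
Qed.

(** With cluster sizes k and k', the difference of the two sides is a nonnegative multiple of (k -
    k')^2. Equal clusters are therefore the worst case, and an empty cluster needs no separate
    treatment. *)
Lemma rsum_inv_mean_degree_le (n : nat) (s : nat -> bool) (al be : R) :
  0 < be <= al -> (0 < n)%nat ->
  rsum n (fun i => / mean_degree n s al be i) <= 2 / (al + be).
Proof.
  intros Hab Hn; set (k := rsum n (indicator s)); set (k' := INR n - k).
  assert (HN : 0 < INR n) by (apply lt_0_INR; lia).
  assert (Hk : 0 <= k <= INR n).
  { split.
    - apply rsum_nonneg; intros; unfold indicator; destruct (s i); lra.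
    - replace (INR n) with (rsum n (fun _ => 1)) by (rewrite rsum_const; ring).
      apply rsum_le; intros; unfold indicator; destruct (s i); lra. }
  rewrite (rsum_ext n _ (fun i => if s i then / (k * al + k' * be) else / (k * be + k' * al))).
  2: { intros i _; unfold mean_degree, same.
       destruct (s i) eqn:E; f_equal; unfold k', k; rewrite <- rsum_indicator_bool;
         apply rsum_ext; intros j _; destruct (s j); reflexivity. }
  rewrite rsum_indicator_bool; fold k k'.
  assert (Hk' : 0 <= k') by (unfold k'; lra).
  assert (Hkk : 0 < k + k') by (unfold k'; lra).
  assert (H1 : 0 < k * al + k' * be) by nra.
  assert (H2 : 0 < k * be + k' * al) by nra.
  assert (E : 2 / (al + be) - (k * / (k * al + k' * be) + k' * / (k * be + k' * al)) =
    be * (al - be) * (k - k') ^ 2 / ((al + be) * (k * al + k' * be) * (k * be + k' * al)))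
    by (field; lra).
  assert (0 <= be * (al - be) * (k - k') ^ 2 / ((al + be) * (k * al + k' * be) * (k * be + k' * al))).
  { apply Rmult_le_pos; [apply Rmult_le_pos; [nra|apply pow2_ge_0]|].
    left; apply Rinv_0_lt_compat; repeat apply Rmult_lt_0_compat; lra. }
  lra.
Qed.

(** * Spectral gap and Chernoff bounds *)

(* The mean part [P - lam J] equals [w (al-be)/2 J] on the complement of the spin vector; the
   degrees absorb it by Cauchy-Schwarz, since [1/d] has nearly the same sum as [1/E d]. *)
Lemma unique_opt_deterministic (n : nat) (A P : nat -> nat -> R) (s : nat -> bool)
    (lam w al be e g t kap : R) :
  (forall i j, A i j = A j i) ->
  (forall i j, P i j = lam + w * (if same s i j then al else - be)) ->
  (0 < n)%nat -> 0 < w -> 0 < al -> 0 < be -> 0 < e -> 0 < g ->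
  g <= w * (INR n * al) -> g <= w * (INR n * be) ->
  (forall u v, is_sign u -> is_sign v -> dsum n (fun i j => (A i j - P i j) * (u i * v j)) <= t) ->
  (forall x, quad n (fun i j => A i j - P i j) x <= kap * rsum n (fun i => x i ^ 2)) ->
  (forall i, (i < n)%nat -> e <= dual_diag n A lam s i) ->
  kap < be / (al + be) * e ->
  w * (al - be) / 2 * (/ (e * g) * t) <= be / (al + be) ->
  sdp_unique_opt n A lam (outer s).
Proof.
  intros Hs HP Hn Hw Hal Hbe He Hg Hg1 Hg2 Ht Hkap Hd Hk Hnum.
  assert (HN : 0 < INR n) by (apply lt_0_INR; lia).
  apply (unique_opt_of_gap n A lam (be / (al + be) * e - kap) s); [assumption|lra|assumption|].
  intros x Hx; set (d := dual_diag n A lam s) in *.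
  set (T := rsum n (fun i => d i * x i ^ 2)).
  set (m := fun i => w * mean_degree n s al be i).
  assert (HT : e * rsum n (fun i => x i ^ 2) <= T).
  { rewrite <- rsum_scal; apply rsum_le; intros i Hi.
    apply Rmult_le_compat_r; [apply pow2_ge_0|auto]. }
  assert (HX : 0 <= rsum n (fun i => x i ^ 2)) by (apply rsum_nonneg; intros; apply pow2_ge_0).
  assert (HT0 : 0 <= T) by nra.
  assert (Hquad : dsum n (fun i j => (A i j - lam) * (x i * x j)) =
    quad n (fun i j => A i j - P i j) x + w * (al - be) / 2 * rsum n x ^ 2).
  { transitivity (quad n (fun i j => A i j - P i j) x + w * (al - be) / 2 * rsum n x ^ 2
      + w * (al + be) / 2 * rsum n (fun i => spin s i * x i) ^ 2); [|rewrite Hx; ring].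
    replace (rsum n x ^ 2) with (rsum n x * rsum n x) by ring.
    replace (rsum n (fun i => spin s i * x i) ^ 2)
      with (rsum n (fun i => spin s i * x i) * rsum n (fun i => spin s i * x i)) by ring.
    unfold quad; rewrite <- !dsum_prod, <- !dsum_scal, <- !dsum_plus; apply dsum_ext.
    intros i j _ _; rewrite HP; unfold same, spin; destruct (s i), (s j); simpl; field. }
  rewrite Hquad; specialize (Hkap x).
  (* The remaining fraction be/(al + be) of [T] is at least that fraction of e |x|^2 and absorbs the
     noise. If al <= be the left side is nonpositive. *)
  assert (Hmain : w * (al - be) / 2 * rsum n x ^ 2 <= (1 - be / (al + be)) * T).
  { assert (Hth : 0 < be / (al + be) < 1).
    { split; [apply Rdiv_lt_0_compat; lra|].
      apply Rmult_lt_reg_r with (al + be); [lra|]; unfold Rdiv; rewrite Rmult_assoc, Rinv_l; lra. }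
    destruct (Rle_lt_dec al be) as [Hle|Hlt].
    { pose proof (pow2_ge_0 (rsum n x)).
      apply Rle_trans with 0; [|apply Rmult_le_pos; lra].
      assert (0 <= w * (be - al) / 2 * rsum n x ^ 2)
        by (apply Rmult_le_pos; [apply Rmult_le_pos; [apply Rmult_le_pos|]|]; lra).
      lra. }
    assert (Hm : forall i, (i < n)%nat -> g <= m i).
    { intros i Hi; unfold m, mean_degree; eapply Rle_trans; [exact Hg2|].
      apply Rmult_le_compat_l; [lra|]; rewrite <- rsum_const; apply rsum_le; intros j _.
      destruct same; lra. }
    (* d - m is, up to signs, the vector (A - P) s. *)
    assert (Hdm : rsum n (fun i => Rabs (d i - m i)) <= t).
    { eapply Rle_trans; [|apply (rsum_abs_rows_le n _ (spin s) t Ht)].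
      - right; apply rsum_ext; intros i Hi.
        assert (E : d i - m i = spin s i * rsum n (fun j => (A i j - P i j) * spin s j)).
        { unfold d, dual_diag, m, mean_degree.
          rewrite <- !rsum_scal, <- rsum_minus; apply rsum_ext; intros j _.
          rewrite HP; unfold same, spin; destruct (s i), (s j); simpl; ring. }
        rewrite E, Rabs_mult.
        replace (Rabs (spin s i)) with 1; [ring|].
        unfold spin; destruct (s i); [now rewrite Rabs_R1|].
        rewrite Rabs_left; lra.
      - intros i; unfold spin; destruct (s i); auto. }
    assert (Hinv := rsum_inv_perturb n d m e g He Hg Hd Hm).
    assert (Hmean : rsum n (fun i => / m i) <= / w * (2 / (al + be))).
    { eapply Rle_trans; [|apply Rmult_le_compat_l;
        [left; now apply Rinv_0_lt_compat|apply (rsum_inv_mean_degree_le n s al be); [lra|auto]]].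
      right; rewrite <- rsum_scal; apply rsum_ext; intros i Hi; unfold m; apply Rinv_mult. }
    assert (Heg : 0 < / (e * g)) by (apply Rinv_0_lt_compat; nra).
    assert (Hh : rsum n (fun i => / d i) <= / w * (2 / (al + be)) + / (e * g) * t).
    { assert (/ (e * g) * rsum n (fun i => Rabs (d i - m i)) <= / (e * g) * t)
        by (apply Rmult_le_compat_l; lra).
      lra. }
    assert (Hcs := sqr_rsum_le_weighted n d x (fun i Hi => Rlt_le_trans _ _ _ He (Hd i Hi))).
    fold T in Hcs.
    assert (Hmu : 0 < w * (al - be) / 2)
      by (apply Rmult_lt_0_compat; [apply Rmult_lt_0_compat|]; lra).
    apply Rle_trans with (w * (al - be) / 2 * (T * (/ w * (2 / (al + be)) + / (e * g) * t))).
    - apply Rmult_le_compat_l; [lra|]; eapply Rle_trans; [exact Hcs|].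
      apply Rmult_le_compat_l; assumption.
    (* (al - be)/(al + be) = 1 - 2 rho with rho = be/(al + be); the numerical hypothesis bounds the
       perturbation by one rho. *)
    - replace (w * (al - be) / 2 * (T * (/ w * (2 / (al + be)) + / (e * g) * t)))
        with (T * ((1 - 2 * (be / (al + be))) + w * (al - be) / 2 * (/ (e * g) * t)))
        by (field; lra).
      rewrite (Rmult_comm (1 - _)); apply Rmult_le_compat_l; lra. }
  assert (be / (al + be) * (e * rsum n (fun i => x i ^ 2)) <= be / (al + be) * T).
  { apply Rmult_le_compat_l; [left; apply Rdiv_lt_0_compat; lra|assumption]. }
  lra.
Qed.

(** * Estimates of Chernoff exponents *)

Lemma exp_monotone (x y : R) : x <= y -> exp x <= exp y.
Proof. intros [H | ->]; [left; now apply exp_increasing|apply Rle_refl]. Qed.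

(** exp(-x) >= 1 - x gives exp x (1 - x) <= 1, and (1 - x)(1 + x + 2 x^2) = 1 + x^2 (1 - 2 x) >=
    1. *)
Lemma exp_sub_1_le (x : R) : x <= / 2 -> exp x - 1 <= x + 2 * x ^ 2.
Proof.
  intros Hx; pose proof (exp_ineq1_le (- x)) as H; pose proof (exp_pos x).
  assert (E : exp x * exp (- x) = 1) by (rewrite <- exp_plus, Rplus_opp_r; apply exp_0).
  assert (exp x * (1 - x) <= 1) by nra.
  assert (0 <= x ^ 2 * (1 - 2 * x)) by (apply Rmult_le_pos; [apply pow2_ge_0|lra]).
  apply Rmult_le_reg_r with (1 - x); [lra|]; nra.
Qed.

Lemma edge_prob_sym (a b : R) (n : nat) (s : nat -> bool) (i j : nat) :
  edge_prob a b n s i j = edge_prob a b n s j i.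
Proof. unfold edge_prob; destruct (s i), (s j); reflexivity. Qed.

(** Second-order expansion: |f_ij + f_ji| <= 2 th <= 1/2 costs 8 th^2 p per pair, shared as 4 th^2 p
    between its orientations. The term n p th covers the diagonal, which carries no edges. *)
Lemma chernoff_bound_small (a b p th : R) (n : nat) (s : nat -> bool)
    (f : nat -> nat -> R) (t : R) :
  (forall i j, 0 <= edge_prob a b n s i j <= p) -> th <= / 4 ->
  (forall i j, Rabs (f i j) <= th) ->
  chernoff_bound a b n s f t <=
  exp (dsum n (fun i j => edge_prob a b n s i j * f i j) + INR n * (p * th)
       + INR n * (INR n * (4 * th ^ 2 * p)) - t).
Proof.
  intros HP Hth Hf; unfold chernoff_bound; apply exp_monotone.
  assert (Hth0 : 0 <= th) by (eapply Rle_trans; [apply Rabs_pos|apply (Hf O O)]).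
  assert (Hf' : forall i j, - th <= f i j <= th).
  { intros i j; specialize (Hf i j); pose proof (Rle_abs (f i j)).
    pose proof (Rle_abs (- f i j)) as H'; rewrite Rabs_Ropp in H'; lra. }
  set (P := edge_prob a b n s) in *.
  assert (Hp0 : 0 <= p) by (specialize (HP O O); lra).
  assert (Hpt : upper n (fun i j => P i j * (exp (f i j + f j i) - 1)) <=
    upper n (fun i j => (P i j * f i j + 4 * th ^ 2 * p) + (P j i * f j i + 4 * th ^ 2 * p))).
  { apply upper_le; intros i j _ _; specialize (HP i j) as Hij.
    unfold P; rewrite (edge_prob_sym a b n s j i); fold P; change (edge_prob a b n s i j) with (P i j).
    pose proof (Hf' i j); pose proof (Hf' j i).
    assert (Hx : exp (f i j + f j i) - 1 <= (f i j + f j i) + 8 * th ^ 2).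
    { eapply Rle_trans; [apply exp_sub_1_le; lra|].
      assert ((f i j + f j i) ^ 2 <= (2 * th) ^ 2) by (apply pow_maj_Rabs; apply Rabs_le; lra).
      lra. }
    assert (P i j * (8 * th ^ 2) <= p * (8 * th ^ 2))
      by (apply Rmult_le_compat_r; [pose proof (pow2_ge_0 th); lra|lra]).
    assert (P i j * (exp (f i j + f j i) - 1) <= P i j * ((f i j + f j i) + 8 * th ^ 2))
      by (apply Rmult_le_compat_l; lra).
    lra. }
  rewrite (upper_symmetrize n (fun i j => P i j * f i j + 4 * th ^ 2 * p)) in Hpt.
  rewrite dsum_plus, rsum_plus in Hpt; unfold dsum at 2 in Hpt; rewrite !rsum_const in Hpt.
  assert (- (INR n * (p * th)) <= rsum n (fun i => P i i * f i i)).
  { replace (- (INR n * (p * th))) with (rsum n (fun _ => - (p * th))) by (rewrite rsum_const; ring).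
    apply rsum_le; intros i _; specialize (HP i i); specialize (Hf' i i); nra. }
  assert (0 <= INR n * (4 * th ^ 2 * p)).
  { apply Rmult_le_pos; [apply pos_INR|]; pose proof (pow2_ge_0 th); nra. }
  lra.
Qed.

(** An edge at k meets row k in only one orientation, so it is tilted once; the term j = k is
    removed since there are no loops. *)
Lemma chernoff_bound_row (a b : R) (n k : nat) (s : nat -> bool) (h : nat -> R) (t : R) :
  (k < n)%nat ->
  chernoff_bound a b n s (fun i j => if Nat.eqb i k then h j else 0) t =
  exp (rsum n (fun j => edge_prob a b n s k j * (exp (h j) - 1))
       - edge_prob a b n s k k * (exp (h k) - 1) - t).
Proof.
  intros Hk; unfold chernoff_bound; do 2 f_equal.
  set (G := fun i j => if Nat.eqb i k then edge_prob a b n s k j * (exp (h j) - 1) else 0).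
  rewrite (upper_ext n _ (fun i j => G i j + G j i)).
  - rewrite upper_symmetrize; unfold G.
    rewrite (dsum_delta_row n k (fun i j => edge_prob a b n s k j * (exp (h j) - 1))) by assumption.
    now rewrite (rsum_delta n k (fun i => edge_prob a b n s k i * (exp (h i) - 1))).
  - intros i j Hij _; unfold G.
    destruct (Nat.eqb_spec i k) as [->|], (Nat.eqb_spec j k) as [->|]; try lia.
    + rewrite !Rplus_0_r; reflexivity.
    + rewrite !Rplus_0_l, (edge_prob_sym a b n s i k); reflexivity.
    + rewrite Rplus_0_r, exp_0; ring.
Qed.

(** A pair inside [S] is counted twice, hence th / 2. There are at most |S|^2/2 such pairs, each
    costing at most p e^th. *)
Lemma chernoff_bound_indicator (a b p th : R) (n : nat) (s S : nat -> bool) (t : R) :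
  (forall i j, 0 <= edge_prob a b n s i j <= p) -> 0 <= th ->
  chernoff_bound a b n s (fun i j => th / 2 * (indicator S i * indicator S j)) t <=
  exp (/ 2 * (p * exp th) * rsum n (indicator S) ^ 2 - t).
Proof.
  intros HP Hth; unfold chernoff_bound; apply exp_monotone; unfold Rminus; apply Rplus_le_compat_r.
  assert (Hp0 : 0 <= p) by (specialize (HP O O); lra).
  pose proof (exp_ineq1_le th).
  set (G := fun i j => / 2 * (p * exp th) * (indicator S i * indicator S j)).
  apply Rle_trans with (upper n (fun i j => G i j + G j i)).
  - apply upper_le; intros i j _ _; unfold G, indicator; specialize (HP i j).
    destruct (S i), (S j).
    1: { replace (th / 2 * (1 * 1) + th / 2 * (1 * 1)) with th by field.
         assert (edge_prob a b n s i j * (exp th + -1) <= p * exp th)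
           by (apply Rmult_le_compat; lra).
         lra. }
    all: match goal with |- _ * (exp ?x + _) <= _ => replace x with 0 by field end;
      rewrite exp_0; lra.
  - rewrite upper_symmetrize; unfold G; rewrite dsum_scal, dsum_prod.
    assert (0 <= rsum n (fun i => / 2 * (p * exp th) * (indicator S i * indicator S i))).
    { apply rsum_nonneg; intros i _; unfold indicator.
      assert (0 <= p * exp th) by (apply Rmult_le_pos; lra); destruct (S i); lra. }
    lra.
Qed.

(** * Enumeration of sign vectors and vertex sets *)

Definition signs (c : list bool) (i : nat) : R := if nth i c false then 1 else -1.

Lemma nth_map_seq (n i : nat) (S : nat -> bool) :
  (i < n)%nat -> nth i (map S (seq 0 n)) false = S i.
Proof.
  intros Hi; rewrite (nth_indep _ false (S O)) by (rewrite length_map, length_seq; assumption).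
  rewrite map_nth, seq_nth by assumption; reflexivity.
Qed.

Lemma in_all_bools_map_seq (n : nat) (S : nat -> bool) : In (map S (seq 0 n)) (all_bools n).
Proof. apply all_bools_length; now rewrite length_map, length_seq. Qed.

(** Makes the union over sign vectors finite. Past the end of the list [signs] reads -1, which no
    sum up to n sees. *)
Lemma is_sign_signs (n : nat) (u : nat -> R) :
  is_sign u -> exists c, In c (all_bools n) /\ forall i, (i < n)%nat -> signs c i = u i.
Proof.
  intros Hu; exists (map (fun i => if Rlt_dec 0 (u i) then true else false) (seq 0 n)).
  split; [apply in_all_bools_map_seq|]; intros i Hi; unfold signs; rewrite nth_map_seq by assumption.
  destruct (Hu i) as [-> | ->]; destruct Rlt_dec; lra.
Qed.

Lemma rsum_nth (c : list bool) (g : bool -> R) :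
  rsum (length c) (fun i => g (nth i c false)) = lsum c g.
Proof.
  rewrite <- lsum_seq; induction c as [|x c IH]; [reflexivity|].
  cbn [length seq]; rewrite !lsum_cons, <- seq_shift, lsum_map; f_equal; exact IH.
Qed.

Lemma lsum_combine_snd {S T : Type} (l : list S) (c : list T) (f : T -> R) :
  length l = length c -> lsum (combine l c) (fun e => f (snd e)) = lsum c f.
Proof.
  revert c; induction l as [|x l IH]; intros [|y c] H; simpl in H; try discriminate.
  - reflexivity.
  - cbn [combine]; rewrite !lsum_cons, IH by lia; reflexivity.
Qed.

(** Each vertex contributes a factor 1 or e^y. With it the union bound runs over subsets of all
    sizes at once. *)
Lemma lsum_subsets_exp (n : nat) (y : R) :
  lsum (all_bools n) (fun c => exp (y * rsum n (indicator (fun i => nth i c false)))) =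
  (1 + exp y) ^ n.
Proof.
  rewrite (lsum_ext _ _ (fun c => lprod (combine (seq 0 n) c)
    (fun e : nat * bool => exp (if snd e then y else 0)))).
  - replace (all_bools n) with (all_bools (length (seq 0 n))) by now rewrite length_seq.
    rewrite lsum_all_bools_lprod; simpl; rewrite exp_0.
    replace ((1 + exp y) ^ n) with ((1 + exp y) ^ length (seq 0 n)) by now rewrite length_seq.
    induction (seq 0 n) as [|i l IH]; [reflexivity|]; rewrite lprod_cons, IH; simpl; ring.
  - intros c Hc; apply all_bools_length in Hc; subst n.
    rewrite lprod_exp, (lsum_combine_snd _ c (fun x : bool => if x then y else 0))
      by apply length_seq.
    f_equal; rewrite <- rsum_nth, <- rsum_scal; apply rsum_ext; intros i _.
    unfold indicator; destruct (nth i c false); ring.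
Qed.

Lemma pow_exp_le (y : R) (n : nat) : (1 + exp y) ^ n <= exp (INR n * exp y).
Proof.
  induction n as [|n IH]; [simpl; rewrite Rmult_0_l, exp_0; lra|].
  rewrite S_INR, Rmult_plus_distr_r, exp_plus, Rmult_1_l; simpl.
  pose proof (exp_pos y).
  rewrite Rmult_comm; apply Rmult_le_compat; [apply pow_le; lra|lra|assumption|apply exp_ineq1_le].
Qed.

Lemma ln_eventually (M : R) : 0 < M ->
  exists N : nat, forall n : nat, (N <= n)%nat -> M <= ln (INR n) /\ M * ln (INR n) <= INR n.
Proof.
  (* exp M gives ln n >= M. The other summand gives sqrt n >= 2 M, which with ln n <= 2 sqrt n
     yields the second bound. *)
  intros HM; destruct (INR_unbounded (exp M + 4 * M ^ 2)) as [N HN]; exists N; intros n Hn.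
  apply le_INR in Hn; pose proof (exp_pos M); pose proof (pow2_ge_0 M).
  assert (Hn0 : 0 < INR n) by lra; split.
  - rewrite <- (ln_exp M); left; apply ln_increasing; lra.
  - set (r := sqrt (INR n)).
    assert (Hr : r * r = INR n) by (apply sqrt_sqrt; lra).
    assert (Hr0 : 0 < r) by (apply sqrt_lt_R0; lra).
    assert (Hln : ln (INR n) <= 2 * r).
    { rewrite <- Hr, ln_mult by assumption.
      pose proof (exp_ineq1_le (ln r)) as H1; rewrite exp_ln in H1 by assumption; lra. }
    assert (2 * M <= r) by (apply Rnot_lt_le; intros Hlt; nra).
    nra.
Qed.

(** * Union bounds *)

Lemma edge_prob_bounds (a b : R) (n : nat) (s : nat -> bool) (i j : nat) :
  0 < b < a -> 0 < ln (INR n) -> (0 < n)%nat -> 0 <= edge_prob a b n s i j <= p_in a n.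
Proof.
  intros Hab HL Hn; assert (HN : 0 < INR n) by (apply lt_0_INR; lia).
  assert (Hw : 0 < ln (INR n) / INR n) by now apply Rdiv_lt_0_compat.
  unfold edge_prob, p_in, q_out, Rdiv in *; rewrite !Rmult_assoc.
  destruct Bool.eqb; nra.
Qed.

Lemma INR_mult_p_in (a : R) (n : nat) : (0 < n)%nat -> INR n * p_in a n = a * ln (INR n).
Proof.
  intros Hn; assert (0 < INR n) by (apply lt_0_INR; lia); unfold p_in; field; lra.
Qed.

Section UnionBounds.

Variables (a b : R) (n : nat) (s : nat -> bool).
Hypothesis Hab : 0 < b < a.
Hypothesis Hn : (0 < n)%nat.
Hypothesis HL : 0 < ln (INR n).

Let L := ln (INR n).
Let P := edge_prob a b n s.

(** The tilt th = eta/(8 a) minimizes 4 th^2 a L - th eta L, with value -eta^2 L/(16 a), and eta <=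
    2 a keeps it below 1/4. The exponent is of order n L, so it beats the 4^n <= e^(2n) pairs of
    sign vectors once L is large. *)
Lemma union_bound_cut (eta : R) :
  0 < eta <= 2 * a -> 16 * a * (3 + eta) <= eta ^ 2 * L -> L <= INR n ->
  lsum (list_prod (all_bools n) (all_bools n)) (fun c => chernoff_bound a b n s
    (fun i j => eta / (8 * a) * (signs (fst c) i * signs (snd c) j))
    (eta / (8 * a) * (eta * INR n * L +
       dsum n (fun i j => P i j * (signs (fst c) i * signs (snd c) j))))) <= exp (- L).
Proof.
  intros Heta HLbig HLn; set (th := eta / (8 * a)).
  assert (Hth : th * (8 * a) = eta) by (unfold th; field; lra).
  assert (Hth0 : 0 < th) by (apply Rdiv_lt_0_compat; lra).
  apply Rle_trans with (lsum (list_prod (all_bools n) (all_bools n)) (fun _ =>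
    exp (th * (a * L) + INR n * (4 * th ^ 2 * (a * L)) - th * (eta * INR n * L)))).
  - apply lsum_le; intros [u v] _; cbn [fst snd].
    eapply Rle_trans; [apply (chernoff_bound_small a b (p_in a n) th)|].
    + intros; now apply edge_prob_bounds.
    + nra.
    + intros i j; rewrite Rabs_mult, (Rabs_pos_eq th) by lra.
      replace (Rabs (signs u i * signs v j)) with 1; [lra|].
      unfold signs; destruct (nth i u false), (nth j v false);
        match goal with |- 1 = Rabs ?x => first
          [ replace x with 1 by ring; now rewrite Rabs_R1
          | replace x with (-1) by ring; rewrite Rabs_left; lra ] end.
    + apply exp_monotone; pose proof (INR_mult_p_in a n Hn) as Hp; fold L in Hp; fold P.
      rewrite (dsum_ext n (fun i j => P i j * (th * _))
        (fun i j => th * (P i j * (signs u i * signs v j)))) by (intros; ring).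
      rewrite dsum_scal.
      replace (INR n * (p_in a n * th)) with (th * (a * L)) by (rewrite <- Hp; ring).
      replace (INR n * (4 * th ^ 2 * p_in a n)) with (4 * th ^ 2 * (a * L))
        by (rewrite <- Hp; ring).
      lra.
  - rewrite lsum_const, length_prod, mult_INR, length_all_bools.
    assert (H2 : 2 ^ n <= exp (INR n)).
    { pose proof (pow_exp_le 0 n) as H; rewrite exp_0, Rmult_1_r in H.
      replace (1 + 1) with 2 in H by ring; exact H. }
    assert (H20 : 0 <= 2 ^ n) by (apply pow_le; lra).
    eapply Rle_trans.
    { apply Rmult_le_compat_r; [left; apply exp_pos|].
      apply Rmult_le_compat; [exact H20|exact H20|exact H2|exact H2]. }
    rewrite <- !exp_plus; apply exp_monotone.
    assert (E : 4 * th ^ 2 * (a * L) - th * (eta * L) = - (eta ^ 2 * L / (16 * a)))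
      by (unfold th; field; lra).
    assert (E2 : th * (a * L) = eta / 8 * L) by (unfold th; field; lra).
    assert (Hbig : 3 + eta <= eta ^ 2 * L / (16 * a)).
    { apply Rmult_le_reg_r with (16 * a); [lra|].
      unfold Rdiv; rewrite (Rmult_assoc (eta ^ 2 * L)), Rinv_l; lra. }
    assert (INR n * (3 + eta) <= INR n * (eta ^ 2 * L / (16 * a)))
      by (apply Rmult_le_compat_l; [apply pos_INR|assumption]).
    assert (eta / 8 * L <= eta / 8 * INR n) by (apply Rmult_le_compat_l; lra).
    assert (0 < eta * INR n) by (apply Rmult_lt_0_compat; [lra|apply lt_0_INR; lia]).
    replace (th * (a * L) + INR n * (4 * th ^ 2 * (a * L)) - th * (eta * INR n * L))
      with (th * (a * L) + INR n * (4 * th ^ 2 * (a * L) - th * (eta * L))) by ring.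
    rewrite E, E2; lra.
Qed.

(** Tilt 1: the mean term is at most (e - 1) a L <= 2 a L, so each vertex fails with probability at
    most n^(-2). *)
Lemma union_bound_degree :
  lsum (seq 0 n) (fun k => chernoff_bound a b n s
    (fun i j => if Nat.eqb i k then 1 else 0) ((2 * a + 2) * L)) <= exp (- L).
Proof.
  apply Rle_trans with (lsum (seq 0 n) (fun _ => exp (- (2 * L)))).
  - apply lsum_le; intros k Hk; apply in_seq in Hk.
    rewrite (chernoff_bound_row a b n k s (fun _ => 1)) by lia; apply exp_monotone.
    pose proof exp_le_3 as H3; pose proof (exp_ineq1_le 1).
    pose proof (INR_mult_p_in a n Hn) as Hp; fold L in Hp.
    assert (rsum n (fun j => edge_prob a b n s k j * (exp 1 - 1)) <= 2 * (a * L)).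
    { rewrite <- Hp, <- Rmult_assoc, (Rmult_comm 2), Rmult_assoc, <- rsum_const.
      apply rsum_le; intros j _; pose proof (edge_prob_bounds a b n s k j Hab HL Hn).
      rewrite (Rmult_comm 2); apply Rmult_le_compat; lra. }
    assert (0 <= edge_prob a b n s k k * (exp 1 - 1))
      by (apply Rmult_le_pos; [now apply edge_prob_bounds|lra]).
    lra.
  - rewrite lsum_const, length_seq.
    rewrite <- (exp_ln (INR n)) at 1 by (apply lt_0_INR; lia).
    fold L; rewrite <- exp_plus; apply exp_monotone; lra.
Qed.

(** Tilt 4/eps turns the threshold into 4 L (m + 1) for a set of size m, and m <= delta n keeps the
    mean term below L m. What is left, exp(-3 L (m + 1)), is summable over all sets; the extra 1 in
    m + 1 supplies the small factor that is independent of m. *)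
Lemma union_bound_sparse (eps delta : R) :
  0 < eps -> 0 < delta -> delta * (a * exp (4 / eps)) <= 2 ->
  lsum (all_bools n) (fun c =>
    let S := fun i => nth i c false in
    if Rle_dec (rsum n (indicator S)) (delta * INR n) then chernoff_bound a b n s
      (fun i j => (4 / eps) / 2 * (indicator S i * indicator S j))
      ((4 / eps) / 2 * (2 * eps * L * (rsum n (indicator S) + 1)))
    else 0) <= 3 * exp (- L).
Proof.
  intros Heps Hdelta Hsmall; set (th := 4 / eps) in *.
  assert (Hth : 0 < th) by (apply Rdiv_lt_0_compat; lra).
  apply Rle_trans with (lsum (all_bools n) (fun c => exp (- (3 * L)) *
    exp (- (3 * L) * rsum n (indicator (fun i => nth i c false))))).
  - apply lsum_le; intros c _; cbv zeta; set (m := rsum n (indicator _)).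
    rewrite <- exp_plus; destruct Rle_dec as [Hm|]; [|left; apply exp_pos].
    eapply Rle_trans; [apply (chernoff_bound_indicator a b (p_in a n))|].
    + intros; now apply edge_prob_bounds.
    + lra.
    + fold m; apply exp_monotone.
      assert (Hm0 : 0 <= m)
        by (apply rsum_nonneg; intros; unfold indicator; destruct (nth i c false); lra).
      replace (th / 2 * (2 * eps * L * (m + 1))) with (4 * L * (m + 1)) by (unfold th; field; lra).
      assert (Hp0 : 0 <= p_in a n)
        by (pose proof (edge_prob_bounds a b n s O O Hab HL Hn); lra).
      assert (/ 2 * (p_in a n * exp th) * m ^ 2 <= L * m).
      { pose proof (INR_mult_p_in a n Hn) as Hp; fold L in Hp.
        pose proof (exp_pos th).
        replace (/ 2 * (p_in a n * exp th) * m ^ 2)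
          with (/ 2 * (p_in a n * exp th) * m * m) by ring.
        apply Rmult_le_compat_r; [assumption|].
        apply Rle_trans with (/ 2 * (p_in a n * exp th) * (delta * INR n)).
        - apply Rmult_le_compat_l; [|assumption].
          apply Rmult_le_pos; [lra|apply Rmult_le_pos; lra].
        - replace (/ 2 * (p_in a n * exp th) * (delta * INR n))
            with (/ 2 * delta * exp th * (INR n * p_in a n)) by ring.
          rewrite Hp.
          replace (/ 2 * delta * exp th * (a * L)) with (/ 2 * L * (delta * (a * exp th))) by ring.
          assert (/ 2 * L * (delta * (a * exp th)) <= / 2 * L * 2)
            by (apply Rmult_le_compat_l; unfold L; lra).
          lra. }
      assert (0 < L) by exact HL; lra.
  - rewrite lsum_scal, lsum_subsets_exp.
    assert (Hpow : (1 + exp (- (3 * L))) ^ n <= 3).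
    { eapply Rle_trans; [apply pow_exp_le|]; eapply Rle_trans; [|apply exp_le_3].
      apply exp_monotone; rewrite <- (exp_ln (INR n)) at 1 by (apply lt_0_INR; lia).
      fold L; rewrite <- exp_plus, <- exp_0; apply exp_monotone; unfold L; lra. }
    assert (exp (- (3 * L)) <= exp (- L)) by (apply exp_monotone; unfold L; lra).
    pose proof (exp_pos (- (3 * L))); pose proof (exp_pos (- L)).
    rewrite Rmult_comm; apply Rmult_le_compat; try lra; apply pow_le; lra.
Qed.

(* The tilt [th = (ln a - ln b) / 2] makes the exponents of inner and outer edges equal. *)
Lemma union_bound_dual (e0 : R) :
  let th := (ln a - ln b) / 2 in
  let lam := lambda_star a b n in
  p_in a n <= 1 ->
  lsum (seq 0 n) (fun k => chernoff_bound a b n s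
    (fun i j => if Nat.eqb i k then - (th * (spin s k * spin s j)) else 0)
    (- (th * (e0 * L + lam * rsum n (fun j => spin s k * spin s j))))) <=
  3 * exp (- (((sqrt a - sqrt b) ^ 2 / 2 - 1 - th * e0) * L)).
Proof.
  intros th lam Hp1; set (w := L / INR n).
  assert (HN : 0 < INR n) by (apply lt_0_INR; lia).
  set (ra := sqrt a); set (rb := sqrt b).
  assert (Hra : 0 < ra) by (apply sqrt_lt_R0; lra).
  assert (Hrb : 0 < rb) by (apply sqrt_lt_R0; lra).
  assert (Ha : a = ra * ra) by (symmetry; apply sqrt_sqrt; lra).
  assert (Hb : b = rb * rb) by (symmetry; apply sqrt_sqrt; lra).
  assert (Hln : 0 < ln a - ln b) by (pose proof (ln_increasing b a); lra).
  assert (Eth : th = ln ra - ln rb).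
  { unfold th; rewrite Ha, Hb, !ln_mult by assumption; field. }
  assert (Hexp : exp th = ra / rb)
    by (rewrite Eth; unfold Rminus; rewrite exp_plus, exp_Ropp, !exp_ln by assumption; reflexivity).
  assert (Hexp' : exp (- th) = rb / ra) by (rewrite exp_Ropp, Hexp; field; lra).
  assert (Hlam : th * lam = w * (a - b) / 2)
    by (unfold lam, lambda_star, tau, th, w; fold L; field; lra).
  apply Rle_trans with (lsum (seq 0 n) (fun _ =>
    exp (- ((ra - rb) ^ 2 / 2 * L) + th * e0 * L + 1))).
  - apply lsum_le; intros k Hk; apply in_seq in Hk.
    rewrite (chernoff_bound_row a b n k s (fun j => - (th * (spin s k * spin s j)))) by lia.
    apply exp_monotone; fold P.
    (* In either cluster, j contributes w (sqrt(a b) - (a + b)/2) = -w (ra - rb)^2/2. This is the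
       cancellation that tau is made for, and it removes the cluster sizes. *)
    assert (Hsum : rsum n (fun j => P k j * (exp (- (th * (spin s k * spin s j))) - 1))
      + th * (lam * rsum n (fun j => spin s k * spin s j)) = - ((ra - rb) ^ 2 / 2 * L)).
    { rewrite <- Rmult_assoc, Hlam, <- rsum_scal, <- rsum_plus.
      rewrite (rsum_ext n _ (fun _ => - ((ra - rb) ^ 2 / 2 * w))).
      - rewrite rsum_const; unfold w; field; lra.
      - intros j _; unfold P, edge_prob, p_in, q_out, spin; fold L.
        destruct (s k), (s j); simpl;
          match goal with |- context [exp ?x] => first
            [ replace x with th by ring; rewrite Hexp
            | replace x with (- th) by ring; rewrite Hexp' ] end;
          unfold w; rewrite Ha, Hb; field; lra. }
    (* The diagonal correction costs at most a factor e, whence the 3 in the bound. *)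
    assert (- (P k k * (exp (- (th * (spin s k * spin s k))) - 1)) <= 1).
    { pose proof (edge_prob_bounds a b n s k k Hab HL Hn) as Hkk; fold P in Hkk.
      pose proof (exp_pos (- (th * (spin s k * spin s k)))).
      assert (0 <= P k k * exp (- (th * (spin s k * spin s k)))) by (apply Rmult_le_pos; lra).
      lra. }
    lra.
  - rewrite lsum_const, length_seq.
    rewrite <- (exp_ln (INR n)) at 1 by assumption.
    fold L; rewrite <- exp_plus.
    replace (L + (- ((ra - rb) ^ 2 / 2 * L) + th * e0 * L + 1))
      with (- (((ra - rb) ^ 2 / 2 - 1 - th * e0) * L) + 1) by ring.
    rewrite exp_plus, (Rmult_comm 3); apply Rmult_le_compat_l; [left; apply exp_pos|apply exp_le_3].
Qed.

End UnionBounds.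

Lemma lsum_filter {T : Type} (p : T -> bool) (l : list T) (f : T -> R) :
  lsum (filter p l) f = lsum l (fun x => if p x then f x else 0).
Proof.
  induction l as [|x l IH]; [reflexivity|]; simpl; rewrite lsum_cons.
  destruct (p x); [rewrite lsum_cons|]; rewrite IH; ring.
Qed.

(** [tau] is the logarithmic mean. With l = ln(a/b), apply e^x > 1 + x at l and at -l. *)
Lemma tau_between (a b : R) : 0 < b < a -> b < tau a b < a.
Proof.
  intros Hab; unfold tau; set (l := ln a - ln b).
  assert (Hl : 0 < l) by (pose proof (ln_increasing b a); unfold l; lra).
  assert (E1 : b * exp l = a).
  { unfold l, Rminus; rewrite exp_plus, exp_Ropp, !exp_ln by lra; field; lra. }
  assert (E2 : a * exp (- l) = b).
  { unfold l; rewrite Ropp_minus_distr; unfold Rminus.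
    rewrite exp_plus, exp_Ropp, !exp_ln by lra; field; lra. }
  pose proof (exp_ineq1 l ltac:(lra)); pose proof (exp_ineq1 (- l) ltac:(lra)).
  split; apply Rmult_lt_reg_r with l; try assumption;
    unfold Rdiv; rewrite Rmult_assoc, Rinv_l by lra; nra.
Qed.

(** * The four families of events and their consequences *)

Definition graph_event (n : nat) (A : nat -> nat -> R) (k : (nat -> nat -> R) * R) : Prop :=
  dsum n (fun i j => A i j * fst k i j) <= snd k.

Section Events.

Variables (a b : R) (n : nat) (s : nat -> bool) (eta eps delta e0 : R).

Let L := ln (INR n).
Let P := edge_prob a b n s.
Let th := (ln a - ln b) / 2.

(** All four families share the shape of a pair (f, t), so they can be concatenated for a single
    union bound. The tilt multiplies both components and is divided out in the specifications. *)
Definition cut_events : list ((nat -> nat -> R) * R) :=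
  map (fun c => (fun i j => eta / (8 * a) * (signs (fst c) i * signs (snd c) j),
     eta / (8 * a) * (eta * INR n * L +
       dsum n (fun i j => P i j * (signs (fst c) i * signs (snd c) j)))))
    (list_prod (all_bools n) (all_bools n)).

Definition degree_events : list ((nat -> nat -> R) * R) :=
  map (fun k => (fun i j => if Nat.eqb i k then 1 else 0, (2 * a + 2) * L)) (seq 0 n).

Definition sparse_events : list ((nat -> nat -> R) * R) :=
  map (fun c => let S := fun i => nth i c false in
      (fun i j => (4 / eps) / 2 * (indicator S i * indicator S j),
       (4 / eps) / 2 * (2 * eps * L * (rsum n (indicator S) + 1))))
    (filter (fun c => if Rle_dec (rsum n (indicator (fun i => nth i c false))) (delta * INR n)
                      then true else false) (all_bools n)).

Definition dual_events : list ((nat -> nat -> R) * R) :=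
  map (fun k => (fun i j => if Nat.eqb i k then - (th * (spin s k * spin s j)) else 0,
      - (th * (e0 * L + lambda_star a b n * rsum n (fun j => spin s k * spin s j)))))
    (seq 0 n).

Variable A : nat -> nat -> R.

Lemma cut_events_spec : 0 < a -> 0 < eta ->
  (forall k, In k cut_events -> graph_event n A k) ->
  forall u v, is_sign u -> is_sign v ->
    dsum n (fun i j => (A i j - P i j) * (u i * v j)) <= eta * INR n * L.
Proof.
  intros Ha Heta H u v Hu Hv.
  destruct (is_sign_signs n u Hu) as [cu [Hcu Eu]].
  destruct (is_sign_signs n v Hv) as [cv [Hcv Ev]].
  specialize (H _ (in_map _ _ (cu, cv) (in_prod _ _ _ _ Hcu Hcv))).
  unfold graph_event in H; cbn [fst snd] in H.
  set (c := eta / (8 * a)) in *; assert (Hc : 0 < c) by (apply Rdiv_lt_0_compat; lra).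
  rewrite (dsum_ext n _ (fun i j => c * (A i j * (signs cu i * signs cv j)))) in H
    by (intros; ring).
  rewrite dsum_scal in H; apply Rmult_le_reg_l in H; [|assumption].
  rewrite (dsum_ext n _ (fun i j => A i j * (signs cu i * signs cv j)
      - P i j * (signs cu i * signs cv j)))
    by (intros; rewrite Eu, Ev by assumption; ring).
  rewrite dsum_minus; lra.
Qed.

Lemma degree_events_spec :
  (forall k, In k degree_events -> graph_event n A k) ->
  forall i, (i < n)%nat -> rsum n (fun j => A i j) <= (2 * a + 2) * L.
Proof.
  intros H k Hk.
  assert (Hin : In k (seq 0 n)) by (apply in_seq; lia).
  specialize (H _ (in_map _ _ k Hin)); unfold graph_event in H; cbn [fst snd] in H.
  rewrite (dsum_ext n _ (fun i j => if Nat.eqb i k then A i j else 0)) in H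
    by (intros i j _ _; destruct (Nat.eqb i k); ring).
  now rewrite dsum_delta_row in H.
Qed.

(** A nonempty set has |S| + 1 <= 2 |S|, which doubles the constant and gives a bound linear in |S|;
    for the empty set both sides vanish. *)
Lemma sparse_events_spec : 0 < eps -> 0 <= L ->
  (forall k, In k sparse_events -> graph_event n A k) ->
  forall S, rsum n (indicator S) <= delta * INR n ->
    dsum n (fun i j => A i j * (indicator S i * indicator S j)) <= 4 * eps * L * rsum n (indicator S).
Proof.
  intros Heps HL H S HS.
  assert (Hpos : forall i, (i < n)%nat -> 0 <= indicator S i)
    by (intros; unfold indicator; destruct (S i); lra).
  destruct (classic (exists i, (i < n)%nat /\ S i = true)) as [[i [Hi HSi]]|Hempty].
  - assert (H1 : 1 <= rsum n (indicator S)).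
    { apply Rle_trans with (indicator S i); [unfold indicator; rewrite HSi; lra|].
      now apply rsum_term_le. }
    set (c := map S (seq 0 n)).
    assert (Ec : forall i, (i < n)%nat -> indicator (fun i => nth i c false) i = indicator S i)
      by (intros; unfold indicator, c; now rewrite nth_map_seq).
    assert (Hin : In c (filter (fun c => if Rle_dec (rsum n (indicator (fun i => nth i c false)))
                      (delta * INR n) then true else false) (all_bools n))).
    { apply filter_In; split; [apply in_all_bools_map_seq|].
      rewrite (rsum_ext n _ _ Ec); destruct Rle_dec; [reflexivity|contradiction]. }
    specialize (H _ (in_map _ _ c Hin)); unfold graph_event in H; cbn [fst snd] in H.
    rewrite (rsum_ext n _ _ Ec) in H.
    assert (Hc : 0 < 4 / eps / 2) by (repeat apply Rdiv_lt_0_compat; lra).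
    rewrite (dsum_ext n _ (fun i j => 4 / eps / 2 * (A i j * (indicator S i * indicator S j)))) in H
      by (intros; rewrite !Ec by assumption; ring).
    rewrite dsum_scal in H; apply Rmult_le_reg_l in H; [|assumption].
    assert (0 <= 2 * eps * L * (rsum n (indicator S) - 1))
      by (apply Rmult_le_pos; [apply Rmult_le_pos|]; lra).
    lra.
  - assert (E : forall i, (i < n)%nat -> indicator S i = 0).
    { intros i Hi; unfold indicator; destruct (S i) eqn:E; [exfalso; eauto|reflexivity]. }
    rewrite (rsum_zero n _ E), (dsum_ext n _ (fun _ _ => 0 * 0)); [rewrite dsum_scal; lra|].
    intros i j Hi _; rewrite (E i Hi); ring.
Qed.

(** The tilt of these events is negative, so their upper bounds become lower bounds on the dual
    diagonal. *)
Lemma dual_events_spec : 0 < th ->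
  (forall k, In k dual_events -> graph_event n A k) ->
  forall i, (i < n)%nat -> e0 * L <= dual_diag n A (lambda_star a b n) s i.
Proof.
  intros Hth H k Hk.
  assert (Hin : In k (seq 0 n)) by (apply in_seq; lia).
  specialize (H _ (in_map _ _ k Hin)); unfold graph_event in H; cbn [fst snd] in H.
  rewrite (dsum_ext n _ (fun i j => if Nat.eqb i k then - th * (A i j * (spin s k * spin s j)) else 0))
    in H by (intros i j _ _; destruct (Nat.eqb i k); ring).
  rewrite (dsum_delta_row n k (fun i j => - th * (A i j * (spin s k * spin s j)))) in H by assumption.
  rewrite rsum_scal in H; unfold dual_diag.
  rewrite (rsum_ext n _ (fun j => A k j * (spin s k * spin s j)
    - lambda_star a b n * (spin s k * spin s j))) by (intros; ring).
  rewrite rsum_minus, (rsum_scal n (lambda_star a b n)).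
  apply Rmult_le_reg_l with th; [assumption|]; lra.
Qed.

End Events.

Theorem theorem3 (a b : R) (hb : 0 < b) (hab : b < a)
    (hgap : (sqrt a - sqrt b) ^ 2 > 2) :
  exists c : R, c > 0 /\
  exists N : nat, forall n : nat, (N <= n)%nat ->
    forall sigma : nat -> bool,
      sbm_prob a b n sigma
        (fun g => sdp_unique_opt n (adj n g) (lambda_star a b n) (outer sigma))
      >= 1 - Rpower (INR n) (- c).
Proof.
  assert (Hab : 0 < b < a) by lra.
  destruct (tau_between a b Hab) as [Ht1 Ht2].
  set (al := a - tau a b); set (be := tau a b - b).
  assert (Hal : 0 < al) by (unfold al; lra).
  assert (Hbe : 0 < be) by (unfold be; lra).
  (* Half of the surplus exponent: e0 = g / th spends th e0 = g on the margin of d_i, and g remains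
     for the failure probability. *)
  set (g := ((sqrt a - sqrt b) ^ 2 / 2 - 1) / 2).
  assert (Hg : 0 < g) by (unfold g; lra).
  set (th := (ln a - ln b) / 2).
  assert (Hth : 0 < th) by (pose proof (ln_increasing b a); unfold th; lra).
  set (e0 := g / th).
  assert (He0 : 0 < e0) by (apply Rdiv_lt_0_compat; lra).
  set (rho := be / (al + be)).
  assert (Hrho : 0 < rho) by (apply Rdiv_lt_0_compat; lra).
  set (g0 := Rmin al be).
  assert (Hg0 : 0 < g0) by (now apply Rmin_glb_lt).
  set (kap := rho * e0 / 2).
  assert (Hkap : 0 < kap) by (unfold kap; nra).
  (* Order of choice: [r] tames the degree and mean terms, where 3 a + 2 = (2 a + 2) + a; [eps]
     compensates the factor r on sparsity; [delta] must satisfy a bound involving e^(4/eps); [eta]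
     comes last and absorbs r^2/delta. Each of the three noise contributions is then at most kap
     L/4, well below the available rho e0 L = 2 kap L. *)
  set (r := 1 + 8 * (3 * a + 2) / kap).
  assert (Hr : 1 < r) by (assert (0 < 8 * (3 * a + 2) / kap)
    by (apply Rdiv_lt_0_compat; lra); unfold r; lra).
  set (eps := kap / (8 * r)).
  assert (Heps : 0 < eps) by (apply Rdiv_lt_0_compat; lra).
  set (delta := Rmin 1 (2 / (a * exp (4 / eps)))).
  assert (Hexp : 0 < a * exp (4 / eps)) by (apply Rmult_lt_0_compat; [lra|apply exp_pos]).
  assert (Hdelta : 0 < delta) by (apply Rmin_glb_lt; [lra|apply Rdiv_lt_0_compat; lra]).
  assert (Hdelta1 : delta <= 1) by apply Rmin_l.
  assert (Hdelta2 : delta * (a * exp (4 / eps)) <= 2).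
  { apply Rle_trans with (2 / (a * exp (4 / eps)) * (a * exp (4 / eps))).
    - apply Rmult_le_compat_r; [lra|apply Rmin_r].
    - right; field; split; [apply Rgt_not_eq, exp_pos|lra]. }
  (* The three entries serve the admissible tilt of the cut bound, the cut term of the noise, and
     the perturbation of the inverse degrees. *)
  set (eta := Rmin (2 * a) (Rmin (kap * delta / (4 * r ^ 2)) (e0 * g0 * rho / (al + be)))).
  assert (Hr2 : 0 < r ^ 2) by nra.
  assert (Heta : 0 < eta).
  { repeat apply Rmin_glb_lt; [lra| |]; apply Rdiv_lt_0_compat; try lra.
    - now apply Rmult_lt_0_compat.
    - apply Rmult_lt_0_compat; [now apply Rmult_lt_0_compat|assumption]. }
  assert (Heta1 : eta <= 2 * a) by apply Rmin_l.
  assert (Heta2 : r ^ 2 * eta / delta <= kap / 4).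
  { assert (H : eta <= kap * delta / (4 * r ^ 2))
      by (eapply Rle_trans; [apply Rmin_r|apply Rmin_l]).
    apply Rle_trans with (r ^ 2 * (kap * delta / (4 * r ^ 2)) / delta).
    - apply Rmult_le_compat_r; [left; now apply Rinv_0_lt_compat|].
      apply Rmult_le_compat_l; lra.
    - right; field; lra. }
  assert (Heta3 : (al + be) * eta / (e0 * g0) <= rho).
  { assert (H : eta <= e0 * g0 * rho / (al + be))
      by (eapply Rle_trans; [apply Rmin_r|apply Rmin_r]).
    assert (0 < e0 * g0) by now apply Rmult_lt_0_compat.
    apply Rle_trans with ((al + be) * (e0 * g0 * rho / (al + be)) / (e0 * g0)).
    - apply Rmult_le_compat_r; [left; now apply Rinv_0_lt_compat|].
      apply Rmult_le_compat_l; lra.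
    - right; field; lra. }
  (* The failure probabilities add up to 5 e^(-L) + 3 e^(-g L) <= 8 e^(-2 c L); halving the exponent
     absorbs the factor 8. *)
  set (c := Rmin g 1 / 2).
  assert (Hc : 0 < c) by (unfold c; assert (0 < Rmin g 1) by (apply Rmin_glb_lt; lra); lra).
  exists c; split; [exact Hc|].
  (* The summands yield, in order, L <= n, a L <= n (so p <= 1), the condition of the cut bound, and
     8 <= c L. The resulting threshold on n is fixed before the labeling is introduced, so the
     estimate is uniform over labelings. *)
  set (M := 1 + a + 16 * a * (3 + eta) / eta ^ 2 + 8 / c).
  assert (HM1 : 0 < 16 * a * (3 + eta) / eta ^ 2)
    by (apply Rdiv_lt_0_compat; [repeat apply Rmult_lt_0_compat; lra|now apply pow_lt]).
  assert (HM2 : 0 < 8 / c) by (apply Rdiv_lt_0_compat; lra).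
  destruct (ln_eventually M ltac:(unfold M; lra)) as [N HN].
  exists N; intros n Hn s; destruct (HN n Hn) as [HLM HnM]; clear HN.
  set (L := ln (INR n)) in *.
  assert (HL : 0 < L) by (unfold M in HLM; lra).
  assert (HML : 0 < M * L) by (apply Rmult_lt_0_compat; unfold M in *; lra).
  assert (HNpos : 0 < INR n) by lra.
  assert (Hn0 : (0 < n)%nat) by (apply INR_lt; exact HNpos).
  assert (HaLn : a * L <= INR n).
  { eapply Rle_trans; [|exact HnM]; apply Rmult_le_compat_r; unfold M; lra. }
  assert (HLn : L <= INR n).
  { eapply Rle_trans; [|exact HnM]; rewrite <- (Rmult_1_l L) at 1.
    apply Rmult_le_compat_r; unfold M; lra. }
  assert (HLeta : 16 * a * (3 + eta) <= eta ^ 2 * L).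
  { apply Rle_trans with (eta ^ 2 * (16 * a * (3 + eta) / eta ^ 2)); [right; field; lra|].
    apply Rmult_le_compat_l; [apply pow2_ge_0|unfold M in HLM; lra]. }
  assert (HcL : 8 <= c * L).
  { apply Rle_trans with (c * (8 / c)); [right; field; lra|].
    apply Rmult_le_compat_l; unfold M in HLM; lra. }
  assert (Hp1 : p_in a n <= 1).
  { apply Rmult_le_reg_l with (INR n); [assumption|]; rewrite INR_mult_p_in by assumption.
    fold L; lra. }
  assert (Hedge := fun i j => edge_prob_bounds a b n s i j Hab HL Hn0).
  set (events := cut_events a b n s eta ++ degree_events a n ++ sparse_events n eps delta
                 ++ dual_events a b n s e0).
  eapply Rge_trans.
  - apply (sbm_prob_union_bound a b n s) with (l := events) (f := fst) (t := snd).
    { intros i j; specialize (Hedge i j); lra. }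
    intros A HA.
    assert (H1 : forall k, In k (cut_events a b n s eta) -> graph_event n (adj n A) k)
      by (intros k Hk; apply HA; unfold events; rewrite !in_app_iff; auto).
    assert (H2 : forall k, In k (degree_events a n) -> graph_event n (adj n A) k)
      by (intros k Hk; apply HA; unfold events; rewrite !in_app_iff; auto).
    assert (H3 : forall k, In k (sparse_events n eps delta) -> graph_event n (adj n A) k)
      by (intros k Hk; apply HA; unfold events; rewrite !in_app_iff; auto).
    assert (H4 : forall k, In k (dual_events a b n s e0) -> graph_event n (adj n A) k)
      by (intros k Hk; apply HA; unfold events; rewrite !in_app_iff; auto).
    assert (Hcut := cut_events_spec a b n s eta (adj n A) ltac:(lra) Heta H1).
    assert (Hdeg := degree_events_spec a n (adj n A) H2).
    assert (Hsparse := sparse_events_spec n eps delta (adj n A) Heps (Rlt_le _ _ HL) H3).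
    assert (Hdual := dual_events_spec a b n s e0 (adj n A) Hth H4).
    fold L in Hcut, Hdeg, Hsparse, Hdual.
    assert (Hquad := fun x => noise_quad_bound n (adj n A) (edge_prob a b n s) (p_in a n)
      ((2 * a + 2) * L) (4 * eps * L) delta (eta * INR n * L) r x (adj_sym n A)
      (fun i j => match adj_01 n A i j with
                  | or_introl E => Req_le_sym _ _ E
                  | or_intror E => Rle_trans _ _ _ Rle_0_1 (Req_le_sym _ _ E) end)
      Hedge Hcut Hdeg Hsparse (conj Hdelta Hdelta1) Hr
      ltac:(apply Rmult_le_pos; [lra|now left]) Hn0).
    set (w := L / INR n).
    assert (Hw : 0 < w) by now apply Rdiv_lt_0_compat.
    assert (HwN : w * INR n = L) by (unfold w; field; lra).
    assert (Hkap' : r ^ 2 * (eta * INR n * L) / (delta * INR n) + r / 2 * (4 * eps * L)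
        + 2 * ((2 * a + 2) * L) / r + 2 * p_in a n * INR n / r < rho * (e0 * L)).
    { replace (2 * p_in a n * INR n / r) with (2 * (a * L) / r)
        by (unfold L; rewrite <- INR_mult_p_in by assumption; field; lra).
      replace (r ^ 2 * (eta * INR n * L) / (delta * INR n) + r / 2 * (4 * eps * L)
          + 2 * ((2 * a + 2) * L) / r + 2 * (a * L) / r)
        with (L * (r ^ 2 * eta / delta + 2 * (r * eps) + 2 * ((3 * a + 2) / r))) by (field; lra).
      replace (rho * (e0 * L)) with (L * (2 * kap)) by (unfold kap; field).
      apply Rmult_lt_compat_l; [assumption|].
      assert (E1 : r * eps = kap / 8) by (unfold eps; field; lra).
      assert (E2 : (3 * a + 2) / r <= kap / 8).
      { apply Rmult_le_reg_r with r; [lra|].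
        unfold Rdiv at 1; rewrite Rmult_assoc, Rinv_l by lra.
        assert (kap / 8 * r = kap / 8 + (3 * a + 2)) by (unfold r; field; lra); lra. }
      lra. }
    apply (unique_opt_deterministic n (adj n A) (edge_prob a b n s) s (lambda_star a b n)
      w al be (e0 * L) (L * g0) (eta * INR n * L) _ (adj_sym n A)) with (10 := Hcut) (11 := Hquad);
      try assumption.
    + intros i j; unfold edge_prob, same, p_in, q_out, lambda_star, w, al, be; fold L.
      destruct Bool.eqb; field; lra.
    + now apply Rmult_lt_0_compat.
    + now apply Rmult_lt_0_compat.
    + rewrite <- Rmult_assoc, HwN; apply Rmult_le_compat_l; [lra|apply Rmin_l].
    + rewrite <- Rmult_assoc, HwN; apply Rmult_le_compat_l; [lra|apply Rmin_r].
    + eapply Rle_trans; [|exact Heta3].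
      replace (w * (al - be) / 2 * (/ (e0 * L * (L * g0)) * (eta * INR n * L)))
        with ((al - be) / 2 * eta / (e0 * g0)) by (unfold w; field; lra).
      apply Rmult_le_compat_r; [left; apply Rinv_0_lt_compat; now apply Rmult_lt_0_compat|].
      apply Rmult_le_compat_r; lra.
  - apply Rle_ge, Rplus_le_compat_l, Ropp_le_contravar.
    unfold events; rewrite !lsum_app.
    unfold cut_events, degree_events, sparse_events, dual_events; rewrite !lsum_map, lsum_filter.
    assert (B1 := union_bound_cut a b n s Hab Hn0 HL eta (conj Heta Heta1) HLeta HLn).
    assert (B2 := union_bound_degree a b n s Hab Hn0 HL).
    assert (B3 := union_bound_sparse a b n s Hab Hn0 HL eps delta Heps Hdelta Hdelta2).
    assert (B4 := union_bound_dual a b n s Hab Hn0 HL e0 Hp1); cbv zeta in B4.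
    fold th in B4; replace (th * e0) with g in B4 by (unfold e0; field; lra).
    replace ((sqrt a - sqrt b) ^ 2 / 2 - 1 - g) with g in B4 by (unfold g; field).
    assert (B3' : lsum (all_bools n) (fun c =>
        if (if Rle_dec (rsum n (indicator (fun i => nth i c false))) (delta * INR n)
            then true else false)
        then let S := fun i => nth i c false in chernoff_bound a b n s
          (fun i j => (4 / eps) / 2 * (indicator S i * indicator S j))
          ((4 / eps) / 2 * (2 * eps * L * (rsum n (indicator S) + 1))) else 0) <= 3 * exp (- L)).
    { eapply Rle_trans; [|exact B3]; right; apply lsum_ext; intros x _; cbv zeta.
      destruct Rle_dec; reflexivity. }
    cbn [fst snd] in *; fold L in B1, B2, B3', B4.
    assert (HcX : 2 * c <= g /\ 2 * c <= 1)
      by (unfold c; pose proof (Rmin_l g 1); pose proof (Rmin_r g 1); lra).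
    assert (X1 : exp (- L) <= exp (- (c * L) + - (c * L))) by (apply exp_monotone; nra).
    assert (X2 : exp (- (g * L)) <= exp (- (c * L) + - (c * L))) by (apply exp_monotone; nra).
    rewrite exp_plus in X1, X2.
    unfold Rpower; fold L; replace (- c * L) with (- (c * L)) by ring.
    assert (X3 : 8 * exp (- (c * L)) <= 1).
    { rewrite exp_Ropp; pose proof (exp_pos (c * L)); pose proof (exp_ineq1_le (c * L)).
      apply Rmult_le_reg_r with (exp (c * L)); [assumption|].
      rewrite Rmult_assoc, Rinv_l; lra. }
    pose proof (exp_pos (- (c * L))).
    assert (X4 : 8 * (exp (- (c * L)) * exp (- (c * L))) <= exp (- (c * L))) by nra.
    eapply Rle_trans; [|exact X4].
    eapply Rle_trans; [apply Rplus_le_compat; [exact B1|apply Rplus_le_compat;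
      [exact B2|apply Rplus_le_compat; [exact B3'|exact B4]]]|].
    lra.
Qed.
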